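(* Let $C$ be a finite-dimensional (possibly graded) complex vector space with a differential $d$ given by a matrix with entries in $\mathbb C[k]=\mathbb C[k_1,\dots,k_m]$, let $Q\in\mathbb C[k]$ be irreducible with $\mathfrak h_k\ne0\Rightarrow Q(k)=0$, and let $q$ be a regular homology point. Then there exist matrices $h,i,p,d',h'$ with entries in $\mathbb C(k)$ whose denominators do not vanish at $q$ such that over $\mathbb C(k)$: (i) $h^2=0$, $hdh=h$, $ip=1-dh-hd$, $pi=1$, and $dhd=d$ holds at $q$; (ii) $pdi=Qd'$, $(d')^2=(h')^2=0$, $h'd'+d'h'=1$. Furthermore $H=h+\frac1Q\,ih'p$ satisfies $H^2=0$ and $Hd+dH=1$. The values of $h,i,p$ at $q$ can be chosen freely subject to (i) at $q$. If $C$ is graded, all of this can be made compatible with the grading.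
   Context: $\mathfrak h_k$ denotes the homology of $C$ with the differential evaluated at $k\in\mathbb C^m$. A point $q\in\mathbb C^m$ is a regular homology point if: $Q(q)=0$ and $q$ is a smooth point of the variety $Q=0$; $\dim\mathfrak h_k=\dim\mathfrak h_q$ for all $k$ with $Q(k)=0$ in a Zariski neighborhood of $q$; and there exists $\xi\in T_q\mathbb C^m$ such that, writing a dot for the derivative along $\xi$ at $q$, $\dot Q\ne0$ and the differential on $\mathfrak h_q$ induced by $\dot d$ (well defined since $\dot dd+d\dot d=0$ and a differential since $2\dot d^2+\ddot dd+d\ddot d=0$) is exact. *)

(* Defs.v *)
From HB Require Import structures.
From mathcomp Require Import all_boot all_algebra.
From mathcomp Require Import complex.
From mathcomp Require Import reals.
From mathcomp Require Import mpoly.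
Set Implicit Arguments.
Unset Strict Implicit.
Unset Printing Implicit Defensive.
Import GRing.Theory.
Local Open Scope ring_scope.

(* Matrices act on column vectors: A : 'M_(a,b) maps C^b to C^a. *)

Definition evalmx (C : comNzRingType) (m a b : nat) (k : 'I_m -> C)
  (A : 'M[{mpoly C[m]}]_(a, b)) : 'M[C]_(a, b) :=
  map_mx (fun p => p.@[k]) A.

(* dimension of the homology ker D / im D of a complex matrix D with D^2 = 0 *)
Definition hdim (F : fieldType) (n : nat) (D : 'M[F]_n) : nat :=
  (\rank (kermx D^T) - \rank D)%N.

Definition dirderiv (C : comNzRingType) (m : nat) (xi q : 'I_m -> C)
  (P : {mpoly C[m]}) : C :=
  \sum_(j < m) xi j * (P^`M(j)).@[q].

Definition dirderiv_mx (C : comNzRingType) (m a b : nat) (xi q : 'I_m -> C)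
  (A : 'M[{mpoly C[m]}]_(a, b)) : 'M[C]_(a, b) :=
  \matrix_(i, j) dirderiv xi q (A i j).

Definition mirreducible (C : idomainType) (m : nat) (Q : {mpoly C[m]}) : Prop :=
  Q != 0 /\ Q \isn't a GRing.unit /\
  forall a b : {mpoly C[m]}, Q = a * b -> a \is a GRing.unit \/ b \is a GRing.unit.

(* q is a smooth point of the hypersurface Q = 0 (Q irreducible, hence
   reduced, so the Jacobian criterion: some partial derivative is nonzero) *)
Definition smooth_point (C : comNzRingType) (m : nat) (Q : {mpoly C[m]})
  (q : 'I_m -> C) : Prop :=
  exists j : 'I_m, (Q^`M(j)).@[q] != 0.

(* the differential on ker D0 / im D0 induced by D1 is exact
   (D1 is assumed to anticommute with D0) *)
Definition induced_exact (C : nzRingType) (n : nat) (D0 D1 : 'M[C]_n) : Prop :=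
  forall x : 'cV[C]_n, D0 *m x = 0 ->
    (exists z : 'cV[C]_n, D1 *m x = D0 *m z) ->
    exists y w : 'cV[C]_n, D0 *m y = 0 /\ x = D1 *m y + D0 *m w.

Definition regular_homology_point (C : fieldType) (m n : nat)
  (d : 'M[{mpoly C[m]}]_n) (Q : {mpoly C[m]}) (q : 'I_m -> C) : Prop :=
  [/\ Q.@[q] = 0, smooth_point Q q,
      (* constant homology dimension on Q = 0 in a Zariski neighbourhood D(g) of q *)
      (exists g : {mpoly C[m]}, g.@[q] != 0 /\
         forall k : 'I_m -> C, Q.@[k] = 0 -> g.@[k] != 0 ->
           hdim (evalmx k d) = hdim (evalmx q d))
    & exists xi : 'I_m -> C, dirderiv xi q Q != 0 /\
        induced_exact (evalmx q d) (dirderiv_mx xi q d)].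

Definition frac_val (C : idomainType) (m : nat) (q : 'I_m -> C)
  (x : {fraction {mpoly C[m]}}) (v : C) : Prop :=
  exists a b : {mpoly C[m]}, b.@[q] != 0 /\ x = tofrac a / tofrac b /\ v = a.@[q] / b.@[q].

Definition mx_val (C : idomainType) (m a b : nat) (q : 'I_m -> C)
  (A : 'M[{fraction {mpoly C[m]}}]_(a, b)) (A0 : 'M[C]_(a, b)) : Prop :=
  forall i j, frac_val q (A i j) (A0 i j).

Definition graded_mx (T : zmodType) (a b : nat) (degr : 'I_a -> int)
  (degc : 'I_b -> int) (s : int) (A : 'M[T]_(a, b)) : Prop :=
  forall i j, degr i != degc j + s -> A i j = 0.

Definition cond_i_at_q (C : nzRingType) (n r : nat) (d0 h0 : 'M[C]_n)
  (i0 : 'M[C]_(n, r)) (p0 : 'M[C]_(r, n)) : Prop :=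
  [/\ h0 *m h0 = 0, h0 *m d0 *m h0 = h0,
      i0 *m p0 = 1%:M - d0 *m h0 - h0 *m d0, p0 *m i0 = 1%:M
    & d0 *m h0 *m d0 = d0].

Definition main_conclusion (C : idomainType) (m n r : nat)
  (d : 'M[{mpoly C[m]}]_n) (Q : {mpoly C[m]}) (q : 'I_m -> C)
  (deg : 'I_n -> int) (degr : 'I_r -> int) (e : int)
  (h : 'M[{fraction {mpoly C[m]}}]_n)
  (i : 'M[{fraction {mpoly C[m]}}]_(n, r)) (p : 'M[{fraction {mpoly C[m]}}]_(r, n))
  (d' h' : 'M[{fraction {mpoly C[m]}}]_r)
  (h0 : 'M[C]_n) (i0 : 'M[C]_(n, r)) (p0 : 'M[C]_(r, n)) : Prop :=
  let dF := map_mx (fun x => tofrac x) d in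
  let QF : {fraction {mpoly C[m]}} := tofrac Q in
  let H := h + QF^-1 *: (i *m h' *m p) in
  [/\ mx_val q h h0, mx_val q i i0, mx_val q p p0,
      (exists d'0, mx_val q d' d'0) & (exists h'0, mx_val q h' h'0)] /\
  [/\ h *m h = 0, h *m dF *m h = h, i *m p = 1%:M - dF *m h - h *m dF,
      p *m i = 1%:M & evalmx q d *m h0 *m evalmx q d = evalmx q d] /\
  [/\ p *m dF *m i = QF *: d', d' *m d' = 0, h' *m h' = 0
    & h' *m d' + d' *m h' = 1%:M] /\
  (H *m H = 0 /\ H *m dF + dF *m H = 1%:M) /\
  [/\ graded_mx deg deg (- e) h, graded_mx deg degr 0 i, graded_mx degr deg 0 p,
      graded_mx degr degr e d' & graded_mx degr degr (- e) h'].

(* Main.v *)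
Require Import Defs.
From HB Require Import structures.
From mathcomp Require Import all_boot all_algebra.
From mathcomp Require Import complex.
From mathcomp Require Import reals.
From mathcomp Require Import mpoly.
From mathcomp Require Import boolp ring.
Import GRing.Theory Num.Theory.
Local Open Scope ring_scope.
Set Implicit Arguments.
Unset Strict Implicit.
Unset Printing Implicit Defensive.

(* Write [d = d0 + (d - d0)] with [d0 = d(q)]. The homological perturbation
   lemma extends a contraction [(h0, i0, p0)] of [d0] to one of [d] over the
   local ring at [q]: [h = h0 (1 + (d - d0) h0)^-1], and so on. At a point [k]
   near [q] with [Q(k) = 0], [d(k)] has the same rank as [d(q)], hence as [h(k)];
   this forces [d h d = d] and thus [p d i = 0] at [k]. By the Nullstellensatz
   [p d i = Q d'] with [d'] regular at [q]. Differentiating this along [xi]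
   identifies [d'(q)] up to a nonzero scalar with the differential induced on
   homology, so [d'(q)] is exact, and a second perturbation extends a contracting
   homotopy of [d'(q)] to [h']. *)

(* [mx_val] alone would denote the constant of that name in [matrix]. *)
Local Notation mx_val := Defs.mx_val.

(** * Factorial rings and the Gauss lemma *)

(** The perturbation formulas keep [h d h = h] but not [d h d = d]. The defect is
    [d - d h d = i (p d i) p], so the whole obstruction sits in the square matrix [p d i] of size
    [r]. Each of [h], [i], [p], [h'] is a constant matrix times an inverse with value [1] at [q];
    this is why the values of [h], [i], [p] at [q] can be prescribed, and why gradings are
    inherited. No convergence is involved: a matrix with invertible value at [q] has an inverse
    whose denominators do not vanish at [q]. Two obstacles shape the text. A fraction has no
    preferred numerator and denominator, so its value at a point is a relation, shown to be
    single-valued; an identity passes to a point by comparing two values of one fraction. And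
    irreducibility speaks of factorizations, while dividing by [Q] needs primality; hence the proof
    that polynomial rings are factorial. *)

Definition rdvd (A : idomainType) (a b : A) : Prop := exists c, b = a * c.

Definition prime_elt (A : idomainType) (p : A) : Prop :=
  [/\ p != 0, p \isn't a GRing.unit
    & forall a b, rdvd p (a * b) -> rdvd p a \/ rdvd p b].

(** The index counts primes with multiplicity and serves as induction measure when primes are
    stripped off. *)
Inductive prime_product (A : idomainType) : nat -> A -> Prop :=
| prime_product_unit u : u \is a GRing.unit -> prime_product 0 u
| prime_product_mul n p a :
    prime_elt p -> prime_product n a -> prime_product n.+1 (p * a).

(** In a domain, existence of prime factorizations implies their uniqueness, so this is the usual
    unique factorization property. *)
Definition factorial_ring (A : idomainType) : Prop :=
  forall a : A, a != 0 -> exists n, prime_product n a.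

Lemma rdvd_add (A : idomainType) (p a b : A) :
  rdvd p a -> rdvd p b -> rdvd p (a + b).
Proof. by case=> c -> [c' ->]; exists (c + c'); rewrite mulrDr. Qed.

Lemma rdvd_unit (A : idomainType) (p u : A) :
  u \is a GRing.unit -> rdvd p u -> p \is a GRing.unit.
Proof. by move=> + [c uE]; rewrite uE unitrM => /andP[]. Qed.

Lemma unitr_neq0 (A : idomainType) (u : A) : u \is a GRing.unit -> u != 0.
Proof. by apply: contraTneq => ->; rewrite unitr0. Qed.

Lemma prime_product_mulu (A : idomainType) n (u a : A) :
  u \is a GRing.unit -> prime_product n a -> prime_product n (u * a).
Proof.
move=> Uu; elim=> {n a}[v Uv|n p a pp _ IH].
  by apply: prime_product_unit; rewrite unitrM Uu.
by rewrite mulrCA; apply: prime_product_mul.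
Qed.

Lemma prime_productM (A : idomainType) n n' (a b : A) :
  prime_product n a -> prime_product n' b -> prime_product (n + n') (a * b).
Proof.
move=> + Hb; elim=> {n a}[v Uv|n p a pp _ IH].
  by rewrite add0n; apply: prime_product_mulu.
by rewrite addSn -mulrA; apply: prime_product_mul.
Qed.

Lemma prime_product_neq0 (A : idomainType) n (a : A) :
  prime_product n a -> a != 0.
Proof.
elim=> {n a}[v Uv|n p a [p0 _ _] _ IH]; last by rewrite mulf_neq0.
by apply: contraTneq Uv => ->; rewrite unitr0.
Qed.

Lemma prime_product_div (A : idomainType) n (p a : A) :
  prime_elt p -> prime_product n (p * a) ->
  exists2 n', n = n'.+1 & prime_product n' a.
Proof.
case=> p0 pU pP; move eqb: (p * a) => b Hb.
elim: Hb a eqb => {n b}[u Uu a ua|n p1 b [p10 p1U p1P] Hb IH a pa].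
  by case/negP: pU; apply: (rdvd_unit Uu); exists a.
have [[c p1E]|[c bE]] : rdvd p p1 \/ rdvd p b by apply: pP; exists a.
- exists n => //.
  have -> : a = c * b by apply: (mulfI p0); rewrite pa p1E mulrA.
  apply: prime_product_mulu => //.
  have [|[e pE]|[e cE]] := p1P p c.
  + by exists 1; rewrite mulr1.
  + suff ec1 : e * c = 1 by have := unitr1 A; rewrite -ec1 unitrM => /andP[].
    by apply: (mulfI p10); rewrite mulrA -pE -p1E mulr1.
  + case/negP: pU; suff: p * e = 1.
      by move=> pe; have := unitr1 A; rewrite -pe unitrM => /andP[].
    by apply: (mulfI p10); rewrite mulrA (mulrC p1) -mulrA -cE -p1E mulr1.
- have [n' nE Hc] := IH _ (esym bE).
  exists n'.+1; rewrite ?nE //.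
  have -> : a = p1 * c by apply: (mulfI p0); rewrite pa bE mulrCA.
  exact: prime_product_mul.
Qed.

Lemma rdvd_polyC (A : idomainType) (p : A) (f : {poly A}) :
  rdvd p%:P f -> forall i, rdvd p f`_i.
Proof. by case=> g -> i; exists g`_i; rewrite coefCM. Qed.

(* Descent on leading terms: if [p] does not divide either leading coefficient
   it does not divide their product, otherwise a leading term can be dropped. *)
Lemma prime_polyC (A : idomainType) (p : A) : prime_elt p -> prime_elt p%:P.
Proof.
case=> p0 pU pP; split; first by rewrite polyC_eq0.
  by rewrite poly_unitE coefC eqxx /= negb_and pU orbT.
move=> f g; have [N] := ubnP (size f + size g).
elim: N f g => // N IH f g leN pfg.
have [->|f0] := eqVneq f 0; first by left; exists 0; rewrite mulr0.
have [->|g0] := eqVneq g 0; first by right; exists 0; rewrite mulr0.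
have drop (u : {poly A}) : u != 0 -> rdvd p (lead_coef u) ->
    exists2 u' : {poly A}, (size u' < size u)%N & exists w, u = u' + p%:P * w.
  move=> u0 [c uE]; exists (u - lead_coef u *: 'X^((size u).-1)); last first.
    exists (c *: 'X^((size u).-1)).
    by rewrite mul_polyC scalerA -uE subrK.
  rewrite -(prednK (n := size u)) ?size_poly_gt0 // ltnS.
  apply/leq_sizeP => j lej.
  rewrite coefB coefZ coefXn; move: lej; rewrite leq_eqVlt => /orP[/eqP<-|ltj].
    by rewrite eqxx mulr1 subrr.
  rewrite gtn_eqF // mulr0 subr0; apply: nth_default.
  by rewrite -(prednK (n := size u)) ?size_poly_gt0.
have [pf|npf] := EM (rdvd p (lead_coef f)).
  have [f' ltf [w fE]] := drop f f0 pf.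
  have [] := IH f' g.
  - by rewrite -ltnS (leq_trans _ leN) // ltnS ltn_add2r.
  - have -> : f' = f - p%:P * w by rewrite fE addrK.
    rewrite mulrBl; apply: rdvd_add => //.
    by exists (- (w * g)); rewrite mulrN mulrA.
  - by case=> c f'E; left; exists (c + w); rewrite fE f'E mulrDr.
  - by right.
have [pg|npg] := EM (rdvd p (lead_coef g)).
  have [g' ltg [w gE]] := drop g g0 pg.
  have [] := IH f g'.
  - by rewrite -ltnS (leq_trans _ leN) // ltnS ltn_add2l.
  - have -> : g' = g - p%:P * w by rewrite gE addrK.
    rewrite mulrBr; apply: rdvd_add => //.
    by exists (- (f * w)); rewrite mulrN mulrCA.
  - by left.
  - by case=> c g'E; right; exists (c + w); rewrite gE g'E mulrDr.
have : rdvd p (lead_coef f * lead_coef g).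
  by rewrite -lead_coefM lead_coefE; apply: rdvd_polyC.
by case/pP => ?; [case: npf | case: npg].
Qed.

Lemma prime_product_polyC (A : idomainType) n (a : A) :
  prime_product n a -> prime_product n a%:P.
Proof.
elim=> {n a}[u Uu|n p a pp _ IH].
  by apply: prime_product_unit; rewrite poly_unitE size_polyC coefC /= Uu unitr_neq0.
by rewrite polyCM; apply: prime_product_mul => //; apply: prime_polyC.
Qed.

Definition primitive (A : idomainType) (f : {poly A}) : Prop :=
  forall p : A, prime_elt p -> ~ rdvd p%:P f.

(** A prime dividing [f] divides its leading coefficient, so each extraction shortens the
    factorization of that coefficient by one and the process ends. *)
Lemma content_primitive (A : idomainType) (f : {poly A}) :
  factorial_ring A -> f != 0 ->
  exists c g n, [/\ f = c%:P * g, prime_product n c & primitive g].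
Proof.
move=> ufd f0; have [n Hl] : exists n, prime_product n (lead_coef f).
  by apply: ufd; rewrite lead_coef_eq0.
elim: n f f0 Hl => [|n IH] f f0 Hl.
  exists 1, f, 0%N; split; rewrite ?mul1r //.
    by apply: prime_product_unit; rewrite unitr1.
  move=> p pp /rdvd_polyC/(_ (size f).-1); rewrite -lead_coefE => -[c lE].
  by move: Hl; rewrite lE => /(prime_product_div pp)[].
have [pr|] := EM (primitive f).
  exists 1, f, 0%N; split; rewrite ?mul1r //.
  by apply: prime_product_unit; rewrite unitr1.
move=> /existsNP[p /not_implyP[pp /contrapT[f' fE]]].
have [||c [g [k [f'E Hc prg]]]] := IH f'.
- by apply: contraNneq f0 => f'0; rewrite fE f'0 mulr0.
- move: Hl; rewrite fE lead_coefM lead_coefC => /(prime_product_div pp)[n' [<-]].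
  by [].
exists (p * c), g, k.+1; split=> //; first by rewrite fE f'E polyCM mulrA.
exact: prime_product_mul.
Qed.

Lemma primitive_rdvd (A : idomainType) n (c : A) (f g : {poly A}) :
  prime_product n c -> primitive f -> rdvd f (c%:P * g) -> rdvd f g.
Proof.
move=> Hc prf; elim: Hc g => {n c}[u Uu|n p a pp _ IH] g [w gE].
  exists (u^-1%:P * w); rewrite mulrCA -gE mulrA -polyCM mulVr // polyC1.
  by rewrite mul1r.
have [p0 _ _] := pp.
apply: IH; have [_ _ /(_ f w)] := prime_polyC pp.
case=> [|/(prf p pp)//|[w' wE]].
  by exists (a%:P * g); rewrite -gE polyCM mulrA.
exists w'; apply: (mulfI (x := p%:P)); first by rewrite polyC_eq0.
by rewrite [LHS]mulrA -polyCM gE wE mulrCA.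
Qed.

(** Each prime of [c] stays prime among polynomials, so it divides [g] or [h] and cancels there
    without changing the size. A splitting over the fraction field thus becomes one over [A]. *)
Lemma prime_product_factor (A : idomainType) n (c : A) (f g h : {poly A}) :
  prime_product n c -> c%:P * f = g * h ->
  exists g' h', [/\ f = g' * h', size g' = size g & size h' = size h].
Proof.
move=> Hc; elim: Hc g h => {n c}[u Uu|n p a [p0 pU pP] _ IH] g h gh.
  exists (u^-1%:P * g), h; split=> //.
    by rewrite -mulrA -gh mulrA -polyCM mulVr // mul1r.
  by rewrite mul_polyC size_scale // invr_eq0 unitr_neq0.
have [_ _ /(_ g h)] := prime_polyC (And3 p0 pU pP).
have pP0 : p%:P != 0 :> {poly A} by rewrite polyC_eq0.
case=> [|[w wE]|[w wE]].
- by exists (a%:P * f); rewrite -gh polyCM mulrA.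
- have [|g' [h' [fE sg sh]]] := IH w h.
    by apply: (mulfI pP0); rewrite [LHS]mulrA -polyCM gh wE mulrA.
  by exists g', h'; split=> //; rewrite sg wE mul_polyC size_scale.
- have [|g' [h' [fE sg sh]]] := IH g w.
    by apply: (mulfI pP0); rewrite [LHS]mulrA -polyCM gh wE mulrCA.
  by exists g', h'; split=> //; rewrite sh wE mul_polyC size_scale.
Qed.

(* [dvdp] over a domain is divisibility over its field of fractions. *)
Lemma dvdp_primitive (A : idomainType) (f g : {poly A}) :
  factorial_ring A -> primitive f -> f %| g -> rdvd f g.
Proof.
move=> ufd prf /Pdiv.WeakIdomain.dvdpP [[c w] /= c0 gE].
have [n Hc] := ufd _ c0.
apply: (primitive_rdvd Hc prf); exists w.
by rewrite mul_polyC gE mulrC.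
Qed.

Lemma rdvd_dvdp (A : idomainType) (f g : {poly A}) : rdvd f g -> f %| g.
Proof. by case=> w ->; apply: dvdp_mulr. Qed.

(** Once the content is removed, a nonconstant primitive [g] either splits over the fraction field
    into smaller factors, covered by induction on the size, or is irreducible there. In the second
    case it is prime over the fraction field by gcd arguments, and primitivity brings the
    divisibility back to [A]. *)
Lemma factorial_poly (A : idomainType) : factorial_ring A -> factorial_ring {poly A}.
Proof.
move=> ufd f; have [N] := ubnP (size f).
elim: N f => // N IH f leN f0.
have [c [g [n [fE Hc prg]]]] := content_primitive ufd f0.
have c0 := prime_product_neq0 Hc.
have g0 : g != 0 by apply: contraNneq f0 => g0; rewrite fE g0 mulr0.
have sg : size g = size f by rewrite fE mul_polyC size_scale.
suff [n' Hg] : exists n', prime_product n' g.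
  by exists (n + n')%N; rewrite fE; apply: prime_productM => //; apply: prime_product_polyC.
have [sg1|sg1] := leqP (size g) 1.
  move: prg g0; rewrite (size1_polyC sg1) polyC_eq0 => prg g0.
  have [n' Hg] := ufd _ g0; exists n'.
  exact: prime_product_polyC.
have [[u [v [a [a0 agE ltu ltv]]]]|nred] := EM (exists u v (a : A),
   [/\ a != 0, a%:P * g = u * v, (size u < size g)%N & (size v < size g)%N]).
  have [k Ha] := ufd _ a0.
  have [u' [v' [gE su sv]]] := prime_product_factor Ha agE.
  have gn : u' * v' != 0 by rewrite -gE.
  have [u'0 v'0] : u' != 0 /\ v' != 0 by move: gn; rewrite mulf_eq0 negb_or => /andP[].
  have [|n1 H1] := IH u' _ u'0; first by rewrite su (leq_trans ltu) // sg -ltnS.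
  have [|n2 H2] := IH v' _ v'0; first by rewrite sv (leq_trans ltv) // sg -ltnS.
  by exists (n1 + n2)%N; rewrite gE; apply: prime_productM.
exists 1%N; rewrite -[g]mulr1; apply: prime_product_mul; last first.
  by apply: prime_product_unit; rewrite unitr1.
split=> //; first by rewrite poly_unitE gtn_eqF.
move=> u v /rdvd_dvdp guv.
suff [gu|gv] : g %| u \/ g %| v; [left|right|]; do ?exact: dvdp_primitive.
have [cop|ncop] := boolP (coprimep g u).
  by right; rewrite -(Gauss_dvdpr v cop).
left; have [[a w] /= a0 aE] := Pdiv.WeakIdomain.dvdpP _ _ (dvdp_gcdl g u).
have sgcd : (size (gcdp g u) <= size g)%N by apply: dvdp_leq => //; apply: dvdp_gcdl.
have [eqs|nes] := eqVneq (size (gcdp g u)) (size g).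
  have := dvdp_size_eqp (dvdp_gcdl g u); rewrite eqs eqxx => /esym eqg.
  by rewrite -(eqp_dvdl _ eqg) dvdp_gcdr.
(* A gcd of size strictly between those of a constant and of [g] would be an excluded splitting. *)
case: nred; exists (gcdp g u), w, a; split=> //.
- by rewrite mul_polyC aE mulrC.
- by rewrite ltn_neqAle nes.
have e0 : gcdp g u != 0 by rewrite gcdp_eq0 negb_and g0.
have w0 : w != 0.
  by apply: contraNneq g0 => w0; rewrite -size_poly_eq0 -(size_scale g a0) aE w0 mul0r size_poly0.
have : size (a *: g) = size (w * gcdp g u) by rewrite aE.
rewrite size_scale // size_mul // => ->.
move: ncop; rewrite /coprimep; move: e0; rewrite -size_poly_eq0.
case: (size (gcdp g u)) => [|[|k]] // _ _.
by rewrite addnS /= addnS ltnS leq_addr.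
Qed.

Lemma can_unit (A B : idomainType) (f : {rmorphism A -> B}) (g : B -> A) b :
  cancel g f -> g b \is a GRing.unit -> b \is a GRing.unit.
Proof. by move=> gK /(rmorph_unit f); rewrite gK. Qed.

Lemma prime_elt_iso (A B : idomainType) (f : {rmorphism A -> B})
    (g : {rmorphism B -> A}) (p : B) :
  cancel f g -> cancel g f -> prime_elt p -> prime_elt (g p).
Proof.
move=> fK gK [p0 pU pP]; split.
- by rewrite -(inj_eq (can_inj fK)) gK rmorph0.
- exact: contra (can_unit gK) pU.
- move=> x y [c xyE]; have [|[e eE]|[e eE]] := pP (f x) (f y).
  + by exists (f c); rewrite -rmorphM xyE rmorphM gK.
  + by left; exists (g e); rewrite -rmorphM -eE fK.
  + by right; exists (g e); rewrite -rmorphM -eE fK.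
Qed.

Lemma factorial_iso (A B : idomainType) (f : {rmorphism A -> B})
    (g : {rmorphism B -> A}) :
  cancel f g -> cancel g f -> factorial_ring B -> factorial_ring A.
Proof.
move=> fK gK ufd a a0.
have [n Ha] : exists n, prime_product n (f a).
  by apply: ufd; rewrite -(inj_eq (can_inj gK)) fK rmorph0.
exists n; rewrite -(fK a); elim: Ha => {n a a0}[u Uu|n p b pp _ IH].
  by apply: prime_product_unit; apply: rmorph_unit.
rewrite rmorphM; apply: prime_product_mul => //; exact: (prime_elt_iso fK).
Qed.

(** A factorization of an irreducible element has a single prime; the cofactor is a unit. *)
Lemma factorial_irreducible_prime (A : idomainType) (a : A) : factorial_ring A ->
  a != 0 -> a \isn't a GRing.unit ->
  (forall b c, a = b * c -> b \is a GRing.unit \/ c \is a GRing.unit) ->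
  prime_elt a.
Proof.
move=> ufd a0 aU irr; have [n Ha] := ufd a a0.
case: Ha a0 aU irr => [u -> //|{}n p b pp Hb pb0 pbU irr].
have [/negP|bU] := irr p b erefl; first by case: pp => _ /negP.
have [p0 pU pP] := pp; split=> // x y [c xyE].
have [|[e eE]|[e eE]] := pP x y; first by exists (b * c); rewrite mulrA.
- by left; exists (b^-1 * e); rewrite -mulrA mulVKr.
- by right; exists (b^-1 * e); rewrite -mulrA mulVKr.
Qed.

(** * The Nullstellensatz for an irreducible hypersurface *)

Lemma mpoly_rmorph_ext n (A S : comNzRingType)
    (f g : {rmorphism {mpoly A[n]} -> S}) :
  (forall c, f c%:MP = g c%:MP) -> (forall i, f 'X_i = g 'X_i) -> f =1 g.
Proof.
move=> fgC fgX p; rewrite (mpolyE p) !rmorph_sum; apply: eq_bigr => m _ /=.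
rewrite -mul_mpolyC !rmorphM fgC mpolyXE_id !rmorph_prod; congr (_ * _).
by apply: eq_bigr => i _; rewrite /= !rmorphXn /= fgX.
Qed.

Lemma muni_widen n (A : comNzRingType) (i : 'I_n) :
  muni ('X_(widen_ord (leqnSn n) i) : {mpoly A[n.+1]}) = ('X_i)%:P.
Proof.
rewrite /muni mmapX mmap1U; case: splitP => [j|j] /= ij.
  by congr (_%:P); congr 'X__; apply: val_inj; rewrite /= -ij.
by have := ltn_ord i; rewrite ij ltnNge leq_addr.
Qed.

Lemma muni_max n (A : comNzRingType) :
  muni ('X_(ord_max) : {mpoly A[n.+1]}) = 'X.
Proof.
rewrite /muni mmapX mmap1U; case: splitP => [j|//] /= ij.
by have := ltn_ord j; rewrite -ij ltnn.
Qed.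

Variant ord_max_spec n : 'I_n.+1 -> Type :=
| OrdMaxWiden j : ord_max_spec (widen_ord (leqnSn n) j)
| OrdMaxMax : ord_max_spec ord_max.

Lemma ord_maxP n (i : 'I_n.+1) : ord_max_spec i.
Proof.
case: (unliftP ord_max i) => [j ->|->]; last exact: OrdMaxMax.
suff -> : lift ord_max j = widen_ord (leqnSn n) j by exact: OrdMaxWiden.
by apply: val_inj => /=; rewrite /bump leqNgt ltn_ord.
Qed.

Definition muni_inv n (A : comNzRingType) :
    {rmorphism {poly {mpoly A[n]}} -> {mpoly A[n.+1]}} :=
  horner_eval 'X_(ord_max) \o map_poly (@mwiden n A).

Lemma mwidenU n (A : comNzRingType) (i : 'I_n) :
  mwiden ('X_i : {mpoly A[n]}) = 'X_(widen_ord (leqnSn n) i).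
Proof. by rewrite mwidenX mnmwiden1. Qed.

Lemma muniK n (A : comNzRingType) : cancel (@muni n A) (muni_inv n A).
Proof.
apply: (mpoly_rmorph_ext (f := muni_inv n A \o @muni n A) (g := idfun)) => /=.
  by move=> c; rewrite muniC /horner_eval map_polyC hornerC /= mwidenC.
move=> i; case: (ord_maxP i) => [j|].
  by rewrite muni_widen /horner_eval map_polyC hornerC /= mwidenU.
by rewrite muni_max /horner_eval map_polyX hornerX.
Qed.

Lemma muni_invK n (A : comNzRingType) : cancel (muni_inv n A) (@muni n A).
Proof.
have mwK c : muni (mwiden c : {mpoly A[n.+1]}) = c%:P.
  apply: (mpoly_rmorph_ext (f := @muni n A \o @mwiden n A) (g := polyC)) => /=.
    by move=> a; rewrite mwidenC muniC.
  by move=> i; rewrite mwidenU muni_widen.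
elim/poly_ind => [|p c IH]; first by rewrite !rmorph0.
rewrite 2!rmorphD 2!rmorphM [X in X * _]IH /=; congr (_ * _ + _).
  by rewrite /horner_eval /= map_polyX hornerX muni_max.
by rewrite /horner_eval /= map_polyC hornerC /= mwK.
Qed.

Definition point_rcons n (C : Type) (k : 'I_n -> C) (t : C) (i : 'I_n.+1) : C :=
  if unlift ord_max i is Some j then k j else t.

Lemma point_rcons_widen n (C : Type) (k : 'I_n -> C) t i :
  point_rcons k t (widen_ord (leqnSn n) i) = k i.
Proof.
rewrite /point_rcons; case: unliftP => [j|] /(congr1 val) /=.
  by rewrite /bump leqNgt ltn_ord => ij; congr k; apply: val_inj.
by move=> ij; have := ltn_ord i; rewrite ij ltnn.
Qed.

Lemma point_rcons_max n (C : Type) (k : 'I_n -> C) t :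
  point_rcons k t ord_max = t.
Proof. by rewrite /point_rcons unlift_none. Qed.

Lemma meval_muni n (A : comNzRingType) (k : 'I_n -> A) t (p : {mpoly A[n.+1]}) :
  p.@[point_rcons k t] = (map_poly (meval k) (muni p)).[t].
Proof.
apply: (mpoly_rmorph_ext (f := meval (point_rcons k t))
  (g := horner_eval t \o map_poly (meval k) \o @muni n A)) => /=.
  by move=> c; rewrite muniC /horner_eval map_polyC hornerC /= !mevalC.
move=> i; rewrite mevalXU /horner_eval; case: (ord_maxP i) => [j|].
  by rewrite muni_widen map_polyC hornerC /= mevalXU point_rcons_widen.
by rewrite muni_max map_polyX hornerX point_rcons_max.
Qed.

Lemma factorial_mpoly (F : fieldType) n : factorial_ring {mpoly F[n]}.
Proof.
elim: n => [|n IH].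
  move=> a a0; exists 0%N; apply: prime_product_unit.
  move: a0; rewrite (nvar0_mpolyC a); set c := _@__ => c0.
  apply: rmorph_unit; rewrite unitfE.
  by apply: contraNneq c0 => ->; rewrite mpolyC0.
exact: (factorial_iso (@muniK n F) (@muni_invK n F)) (factorial_poly IH).
Qed.

Lemma polyC_nonroot (C : numFieldType) (p : {poly C}) :
  p != 0 -> exists t, p.[t] != 0.
Proof.
move=> p0; apply: contrapT => /forallNP pr.
have := @max_poly_roots _ p [seq i%:R | i <- iota 0 (size p)] p0.
rewrite size_map size_iota ltnn => pF; apply: notF; apply: pF.
  by apply/allP => x _; apply/negPn/negP/pr.
by rewrite map_inj_uniq ?iota_uniq // => i j /eqP; rewrite eqr_nat => /eqP.
Qed.

Lemma mpoly_nonroot (C : numFieldType) n (p : {mpoly C[n]}) :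
  p != 0 -> exists k, p.@[k] != 0.
Proof.
elim: n p => [|n IH] p p0.
  exists (fun _ => 0); move: p0; rewrite (nvar0_mpolyC p) mevalC.
  by apply: contraNneq => ->; rewrite mpolyC0.
have [|k lk] := IH (lead_coef (muni p)).
  by rewrite lead_coef_eq0 -(inj_eq (can_inj (@muni_invK n C))) muniK rmorph0.
have [|t pt] := @polyC_nonroot _ (map_poly (meval k) (muni p)).
  apply: contraNneq lk => /(congr1 (fun q : {poly _} => q`_(size (muni p)).-1)).
  by rewrite coef_map coef0 -lead_coefE => ->.
by exists (point_rcons k t); rewrite meval_muni.
Qed.

Lemma mpoly_irreducible_prime (F : fieldType) n (Q : {mpoly F[n]}) :
  mirreducible Q -> prime_elt Q.
Proof.
case=> Q0 [QU Qirr].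
exact: factorial_irreducible_prime (@factorial_mpoly F n) Q0 QU Qirr.
Qed.

Lemma rmorph_bezout0 (A B : pzRingType) (f : {rmorphism A -> B}) (a b c e x y : A) :
  a * (b * x + c * y) = e -> f x = 0 -> f y = 0 -> f e = 0.
Proof. by move=> <- fx fy; rewrite rmorphM rmorphD !rmorphM fx fy !mulr0 addr0 mulr0. Qed.

(* In the last variable, an irreducible [Q] that does not divide [f] is coprime
   to [f] over the fraction field of the coefficients, so [u Q + v f = c] with
   [c] free of that variable; this is absurd over a point where [c] and the
   leading coefficient of [Q] do not vanish. *)
Lemma irreducible_nullstellensatz (C : numClosedFieldType) n (Q f : {mpoly C[n]}) :
  mirreducible Q -> (forall k, Q.@[k] = 0 -> f.@[k] = 0) -> rdvd Q f.
Proof.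
elim: n Q f => [|n IH] Q f Qirr Qf.
  (* Without variables every nonzero polynomial is a unit, so none is irreducible. *)
  case: Qirr => Q0 [/negP[]]; move: Q0; rewrite (nvar0_mpolyC Q).
  set c := _@__ => c0; apply: rmorph_unit; rewrite unitfE.
  by apply: contraNneq c0 => ->; rewrite mpolyC0.
have mK := @muniK n C; have mVK := @muni_invK n C.
have Qpr := mpoly_irreducible_prime Qirr.
suff [g gE] : rdvd (muni Q) (muni f).
  by exists (muni_inv n C g); rewrite -(mK f) gE rmorphM mK.
have Qf' k t : (map_poly (meval k) (muni Q)).[t] = 0 ->
    (map_poly (meval k) (muni f)).[t] = 0.
  by have := Qf (point_rcons k t); rewrite !meval_muni.
have Upr : prime_elt (muni Q) := prime_elt_iso (f := muni_inv n C) (g := @muni n C) mVK mK Qpr.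
have [Q0 QU QP] := Upr.
(* If [Q] is free of the last variable, [f] vanishes on whole lines over the zeros of [a], so all
   its coefficients vanish there and induction applies to each. *)
have [s1|s1] := leqP (size (muni Q)) 1.
  have QE := size1_polyC s1; set a := (muni Q)`_0 in QE.
  have airr : mirreducible a.
    split; first by apply: contraNneq Q0 => a0; rewrite QE a0 polyC0.
    split.
      apply: contra QU => aU; rewrite QE; exact: rmorph_unit.
    have unitI b : muni_inv n C b%:P \is a GRing.unit -> b \is a GRing.unit.
      by move=> /(can_unit mVK); rewrite poly_unitE coefC /= => /andP[].
    move=> b c abc; case: Qirr => _ [_ Qirr].
    have [|/unitI bU|/unitI cU] := Qirr (muni_inv n C b%:P) (muni_inv n C c%:P).
    + by rewrite -[LHS]mK QE abc polyCM rmorphM.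
    + by left.
    + by right.
  have /choice[g gE] : forall i, rdvd a (muni f)`_i.
    move=> i; apply: IH => // k ak; rewrite -coef_map.
    suff -> : map_poly (meval k) (muni f) = 0 by rewrite coef0.
    apply: contrapT => /eqP/polyC_nonroot[t /eqP[]]; apply: Qf'.
    by rewrite QE map_polyC hornerC /= ak.
  exists (\poly_(i < size (muni f)) g i); rewrite QE; apply/polyP => i.
  rewrite coefCM coef_poly; case: ltnP => [_|/leq_sizeP/(_ i (leqnn i))->] //.
  by rewrite mulr0.
apply: contrapT => nQf.
have [[c w] /= c0 cE] := Pdiv.WeakIdomain.dvdpP _ _ (dvdp_gcdl (muni Q) (muni f)).
have cop : coprimep (muni Q) (muni f).
  have C0 : c%:P != 0 :> {poly {mpoly C[n]}} by rewrite polyC_eq0.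
  have cQ : c%:P * muni Q = w * gcdp (muni Q) (muni f) by rewrite -cE mul_polyC.
  (* [Q] is prime and divides [w] times the gcd. If it divides [w], the gcd divides a nonzero
     constant. If it divides the gcd, it divides [a * f] with [a] a nonzero constant, hence [a],
     excluded by size, or [f], excluded by assumption. *)
  have [|[v vE]|[v vE]] := QP w (gcdp (muni Q) (muni f)).
  - by exists c%:P; rewrite -cQ mulrC.
  - have {}cQ : c%:P = v * gcdp (muni Q) (muni f).
      by apply: (mulfI Q0); rewrite mulrC cQ vE mulrA.
    have: v * gcdp (muni Q) (muni f) != 0 by rewrite -cQ.
    rewrite mulf_eq0 negb_or => /andP[v0 g0].
    have := congr1 (fun q : {poly {mpoly C[n]}} => size q) cQ.
    rewrite size_polyC c0 size_mul // /coprimep.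
    move: v0 g0; rewrite -!size_poly_eq0.
    by case: (size v) (size (gcdp _ _)) => [|[|?]] [|[|?]] //; rewrite !addnS.
  - have [[a z] /= a0 aE] := Pdiv.WeakIdomain.dvdpP _ _ (dvdp_gcdr (muni Q) (muni f)).
    have [|[y ay]|//] := QP a%:P (muni f).
      by exists (v * z); rewrite mul_polyC aE vE [LHS]mulrC -mulrA.
    have y0 : y != 0 by apply: contraNneq a0 => y0; rewrite -polyC_eq0 ay y0 mulr0.
    have := congr1 (fun q : {poly {mpoly C[n]}} => size q) ay.
    rewrite size_polyC a0 size_mul //; move: s1 y0; rewrite -size_poly_eq0.
    by case: (size (muni Q)) (size y) => [|[|?]] [|?] //; rewrite !addnS.
have [[u v] /= /eqpP[[c1 c2] /= /andP[c10 c20] uvE]] := Bezout_coprimepP _ _ cop.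
have [|k] := @mpoly_nonroot _ _ (c2 * lead_coef (muni Q)).
  by rewrite mulf_neq0 // lead_coef_eq0.
rewrite mevalM mulf_eq0 negb_or => /andP[c2k lk].
(* The leading coefficient survives at [k], so the specialized [Q] keeps its positive degree. *)
have [t Qt] : exists t, root (map_poly (meval k) (muni Q)) t.
  apply/closed_rootP; rewrite size_map_poly_id0; first by rewrite neq_ltn s1 orbT.
  exact: lk.
move/rootP: Qt => Qt; case/eqP: c2k.
have c2E : c1%:P * (u * muni Q + v * muni f) = c2%:P.
  by rewrite !mul_polyC uvE -mul_polyC mulr1.
have := rmorph_bezout0 (f := horner_eval t \o map_poly (meval k)) c2E Qt (Qf' k t Qt).
by rewrite /= /horner_eval map_polyC hornerC.
Qed.

(** * Graded matrices and contractions *)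

(** Projection to the homogeneous component of degree [s]. It commutes with multiplication by graded
    matrices, so it turns solutions of linear equations with graded coefficients into graded
    solutions. *)
Definition hpart (T : zmodType) a b (da : 'I_a -> int) (db : 'I_b -> int)
    (s : int) (A : 'M[T]_(a, b)) : 'M[T]_(a, b) :=
  \matrix_(i, j) if da i == db j + s then A i j else 0.

Lemma graded_hpart (T : zmodType) a b (da : 'I_a -> int) (db : 'I_b -> int) s
    (A : 'M[T]_(a, b)) : graded_mx da db s (hpart da db s A).
Proof. by move=> i j /negPf ne; rewrite mxE ne. Qed.

Lemma hpart_id (T : zmodType) a b (da : 'I_a -> int) (db : 'I_b -> int) s
    (A : 'M[T]_(a, b)) : graded_mx da db s A -> hpart da db s A = A.
Proof.
by move=> gA; apply/matrixP => i j; rewrite mxE; case: eqVneq => // /gA ->.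
Qed.

Lemma graded0 (T : zmodType) a b (da : 'I_a -> int) (db : 'I_b -> int) s :
  graded_mx da db s (0 : 'M[T]_(a, b)).
Proof. by move=> i j _; rewrite mxE. Qed.

Lemma gradedD (T : zmodType) a b (da : 'I_a -> int) (db : 'I_b -> int) s
    (A B : 'M[T]_(a, b)) :
  graded_mx da db s A -> graded_mx da db s B -> graded_mx da db s (A + B).
Proof. by move=> gA gB i j ne; rewrite mxE gA // gB // addr0. Qed.

Lemma gradedB (T : zmodType) a b (da : 'I_a -> int) (db : 'I_b -> int) s
    (A B : 'M[T]_(a, b)) :
  graded_mx da db s A -> graded_mx da db s B -> graded_mx da db s (A - B).
Proof. by move=> gA gB i j ne; rewrite !mxE gA // gB // subr0. Qed.

Lemma graded1 (T : pzRingType) a (da : 'I_a -> int) :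
  graded_mx da da 0 (1%:M : 'M[T]_a).
Proof. by move=> i j; rewrite mxE addr0; case: (eqVneq i j) => // ->; rewrite eqxx. Qed.

Lemma graded_map (T S : zmodType) (f : {additive T -> S}) a b
    (da : 'I_a -> int) (db : 'I_b -> int) s (A : 'M[T]_(a, b)) :
  graded_mx da db s A -> graded_mx da db s (map_mx f A).
Proof. by move=> gA i j ne; rewrite mxE gA // raddf0. Qed.

Lemma gradedM (T : pzRingType) a b c (da : 'I_a -> int) (db : 'I_b -> int)
    (dc : 'I_c -> int) s t (A : 'M[T]_(a, b)) (B : 'M[T]_(b, c)) :
  graded_mx da db s A -> graded_mx db dc t B ->
  graded_mx da dc (s + t) (A *m B).
Proof.
move=> gA gB i j ne; rewrite mxE big1 // => k _.
have [ik|ik] := eqVneq (da i) (db k + s); last by rewrite gA ?mul0r.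
rewrite gB ?mulr0 //; apply: contraNneq ne => kj.
by rewrite ik kj -addrA [t + s]addrC.
Qed.

Lemma hpart_mull (T : pzRingType) a b c (da : 'I_a -> int) (db : 'I_b -> int)
    (dc : 'I_c -> int) s t (A : 'M[T]_(a, b)) (B : 'M[T]_(b, c)) :
  graded_mx da db s A -> hpart da dc (s + t) (A *m B) = A *m hpart db dc t B.
Proof.
move=> gA; apply/matrixP => i j; rewrite !mxE.
have [ij|ij] := eqVneq; last first.
  rewrite big1 // => k _; rewrite mxE; case: eqVneq => [kj|_]; last by rewrite mulr0.
  rewrite gA ?mul0r //; apply: contraNneq ij => ->.
  by rewrite kj -addrA [t + s]addrC.
apply: eq_bigr => k _; rewrite mxE; case: eqVneq => // kj.
rewrite mulr0 gA ?mul0r //; apply: contraNneq kj => ik.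
by apply/eqP; apply: (addIr s); rewrite -ik ij -addrA [t + s]addrC.
Qed.

Lemma hpart_mulr (T : pzRingType) a b c (da : 'I_a -> int) (db : 'I_b -> int)
    (dc : 'I_c -> int) s t (A : 'M[T]_(a, b)) (B : 'M[T]_(b, c)) :
  graded_mx db dc t B -> hpart da dc (s + t) (A *m B) = hpart da db s A *m B.
Proof.
move=> gB; apply/matrixP => i j; rewrite !mxE.
have [ij|ij] := eqVneq; last first.
  rewrite big1 // => k _; rewrite mxE; case: eqVneq => [ik|_]; last by rewrite mul0r.
  rewrite gB ?mulr0 //; apply: contraNneq ij => kj.
  by rewrite ik kj -addrA [t + s]addrC.
apply: eq_bigr => k _; rewrite mxE; case: eqVneq => // ik.
rewrite mul0r gB ?mulr0 //; apply: contraNneq ik => kj.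
by rewrite ij kj -addrA [t + s]addrC.
Qed.

Lemma graded_invmx (T : comUnitRingType) a (da : 'I_a -> int) (A : 'M[T]_a) :
  A \in unitmx -> graded_mx da da 0 A -> graded_mx da da 0 (invmx A).
Proof.
move=> UA gA; suff -> : invmx A = hpart da da 0 (invmx A) by apply: graded_hpart.
rewrite -[RHS](mulKmx UA) -(hpart_mull _ _ _ gA) addr0 mulmxV //.
by rewrite hpart_id ?mulmx1 //; apply: graded1.
Qed.

(** * Contractions, the perturbation lemma, and ranks *)

Definition contraction (T : pzRingType) n r (d h : 'M[T]_n) (i : 'M[T]_(n, r))
    (p : 'M[T]_(r, n)) : Prop :=
  [/\ h *m h = 0, h *m d *m h = h, i *m p = 1%:M - d *m h - h *m d
    & p *m i = 1%:M].

Lemma contraction_map (T S : nzRingType) (f : {rmorphism T -> S}) n r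
    (d h : 'M[T]_n) (i : 'M[T]_(n, r)) (p : 'M[T]_(r, n)) :
  contraction d h i p ->
  contraction (map_mx f d) (map_mx f h) (map_mx f i) (map_mx f p).
Proof.
case=> hh hdh ip pi; split.
- by rewrite -map_mxM hh map_mx0.
- by rewrite -!map_mxM hdh.
- by rewrite -!map_mxM ip !map_mxB map_mx1.
- by rewrite -map_mxM pi map_mx1.
Qed.

Lemma contraction_hi (T : pzRingType) n r (d h : 'M[T]_n) (i : 'M[T]_(n, r))
    (p : 'M[T]_(r, n)) : contraction d h i p -> h *m i = 0.
Proof.
case=> hh hdh ip pi; rewrite -(mulmx1 i) -pi (mulmxA i) ip mulmxA.
by rewrite !mulmxBr mulmx1 !mulmxA hdh hh mul0mx subr0 subrr mul0mx.
Qed.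

Lemma contraction_ph (T : pzRingType) n r (d h : 'M[T]_n) (i : 'M[T]_(n, r))
    (p : 'M[T]_(r, n)) : contraction d h i p -> p *m h = 0.
Proof.
case=> hh hdh ip pi; rewrite -(mul1mx p) -pi -(mulmxA p) ip -mulmxA.
by rewrite !mulmxBl mul1mx -!mulmxA hh (mulmxA h) hdh mulmx0 subr0 subrr mulmx0.
Qed.

Lemma contraction_di (T : pzRingType) n r (d h : 'M[T]_n) (i : 'M[T]_(n, r))
    (p : 'M[T]_(r, n)) : d *m d = 0 -> d *m h *m d = d ->
  contraction d h i p -> d *m i = 0.
Proof.
move=> dd dhd [_ _ ip pi]; rewrite -(mulmx1 i) -pi (mulmxA i) ip mulmxA.
by rewrite !mulmxBr mulmx1 !mulmxA dd dhd mul0mx subr0 subrr mul0mx.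
Qed.

Lemma contraction_pd (T : pzRingType) n r (d h : 'M[T]_n) (i : 'M[T]_(n, r))
    (p : 'M[T]_(r, n)) : d *m d = 0 -> d *m h *m d = d ->
  contraction d h i p -> p *m d = 0.
Proof.
move=> dd dhd [_ _ ip pi]; rewrite -(mul1mx p) -pi -(mulmxA p) ip -mulmxA.
by rewrite !mulmxBl mul1mx -!mulmxA dd (mulmxA d) dhd mulmx0 subr0 subrr mulmx0.
Qed.

Lemma contraction_pdh (T : pzRingType) n r (d h : 'M[T]_n) (i : 'M[T]_(n, r))
    (p : 'M[T]_(r, n)) : contraction d h i p -> p *m d *m h = 0.
Proof.
move=> c; have ph := contraction_ph c; case: c => _ _ ip pi.
have -> : p *m d *m h = p *m (1%:M - h *m d - i *m p).
  by rewrite ip !opprB addrA subrK addrC subrK mulmxA.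
by rewrite !mulmxBr mulmx1 !mulmxA ph pi mul0mx mul1mx subr0 subrr.
Qed.

Lemma contraction_hdi (T : pzRingType) n r (d h : 'M[T]_n) (i : 'M[T]_(n, r))
    (p : 'M[T]_(r, n)) : contraction d h i p -> h *m d *m i = 0.
Proof.
move=> c; have hi := contraction_hi c; case: c => _ _ ip pi.
have -> : h *m d *m i = (1%:M - d *m h - i *m p) *m i.
  by rewrite ip opprB addrC subrK.
by rewrite !mulmxBl mul1mx -!mulmxA hi pi mulmx0 mulmx1 subr0 subrr.
Qed.

(** With the next lemma: [p] and [i] intertwine [d] and [p d i] even where the latter is nonzero. *)
Lemma contraction_pd_split (T : pzRingType) n r (d h : 'M[T]_n)
    (i : 'M[T]_(n, r)) (p : 'M[T]_(r, n)) : d *m d = 0 ->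
  contraction d h i p -> p *m d *m i *m p = p *m d.
Proof.
move=> dd c; have pdh := contraction_pdh c; case: c => _ _ ip _.
rewrite -(mulmxA _ i) ip !mulmxBr mulmx1 !mulmxA pdh mul0mx subr0.
by rewrite -(mulmxA p) dd mulmx0 mul0mx subr0.
Qed.

Lemma contraction_di_split (T : pzRingType) n r (d h : 'M[T]_n)
    (i : 'M[T]_(n, r)) (p : 'M[T]_(r, n)) : d *m d = 0 ->
  contraction d h i p -> i *m (p *m d *m i) = d *m i.
Proof.
move=> dd c; have hdi := contraction_hdi c; case: c => _ _ ip _.
rewrite !mulmxA ip !mulmxBl mul1mx -!mulmxA (mulmxA d d) dd mul0mx mulmx0 subr0.
by rewrite (mulmxA h) hdi mulmx0 subr0.
Qed.

Lemma contraction_square0 (T : pzRingType) n r (d h : 'M[T]_n)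
    (i : 'M[T]_(n, r)) (p : 'M[T]_(r, n)) : d *m d = 0 ->
  contraction d h i p -> (p *m d *m i) *m (p *m d *m i) = 0.
Proof.
move=> dd c; rewrite -(mulmxA (p *m d)) (contraction_di_split dd c) mulmxA.
by rewrite -(mulmxA p) dd mulmx0 mul0mx.
Qed.

(** The geometric series of the homological perturbation lemma are replaced by two-sided inverses
    [a] of [X] and [b] of [Y]. The exchange rule [Y h0 = h0 X] gives [b h0 = h0 a], which yields the
    identities for [h]; the formula for [i p] is checked after multiplying by [Y] on the left and
    [X] on the right. *)
Lemma contraction_perturb (T : comNzRingType) n r (d0 d h0 a b : 'M[T]_n)
    (i0 : 'M[T]_(n, r)) (p0 : 'M[T]_(r, n)) :
  d0 *m d0 = 0 -> d *m d = 0 -> contraction d0 h0 i0 p0 ->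
  a *m (1%:M + (d - d0) *m h0) = 1%:M -> (1%:M + (d - d0) *m h0) *m a = 1%:M ->
  b *m (1%:M + h0 *m (d - d0)) = 1%:M -> (1%:M + h0 *m (d - d0)) *m b = 1%:M ->
  contraction d (h0 *m a) (b *m i0) (p0 *m a).
Proof.
set X := 1%:M + _ *m h0; set Y := 1%:M + h0 *m _.
move=> dd0 dd c aX Xa bY Yb.
have hi := contraction_hi c; have ph := contraction_ph c.
case: c => hh hdh ip pi.
have Yh : Y *m h0 = h0 *m X by rewrite mulmxDl [RHS]mulmxDr mul1mx mulmx1 mulmxA.
have bh : b *m h0 = h0 *m a.
  by rewrite -[h0 in LHS]mulmx1 -Xa (mulmxA h0) -Yh !mulmxA bY mul1mx.
have hY : h0 *m Y = h0 by rewrite mulmxDr mulmx1 mulmxA hh mul0mx addr0.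
have hb : h0 *m b = h0 by rewrite -{1}hY -mulmxA Yb mulmx1.
have hdhX : h0 *m d *m h0 = Y *m h0.
  by rewrite [RHS]mulmxDl mul1mx mulmxBr mulmxBl hdh addrC subrK.
have XaE : a = 1%:M - (d - d0) *m h0 *m a.
  by rewrite -Xa /X mulmxDl mul1mx addrK.
(* Linearizes the middle of [p0 a b i0]. As [p0 h0 = 0] and [h0 i0 = 0], one has [p0 b = p0] and
   [a i0 = i0], so [p i] becomes [1 + 1 - 1]. *)
have ab : a *m b = b + a - 1%:M.
  have DhabE : (d - d0) *m h0 *m a *m b = 1%:M - a.
    rewrite -(mulmxA _ h0) -bh -mulmxA -(mulmxA b) hb bh mulmxA.
    by rewrite [in RHS]XaE opprB addrCA subrr addr0.
  by rewrite {1}XaE mulmxBl mul1mx DhabE opprB addrA.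
split.
- by rewrite mulmxA -bh -(mulmxA b) hh mulmx0 mul0mx.
- by rewrite -bh -!mulmxA bh (mulmxA d) (mulmxA h0) (mulmxA h0 d) hdhX !mulmxA bY mul1mx.
- have YWX : Y *m (1%:M - d *m (h0 *m a) - h0 *m a *m d) *m X = i0 *m p0.
    have t2 : Y *m (d *m (h0 *m a)) *m X = d *m h0 + h0 *m (d - d0) *m d *m h0.
      by rewrite !mulmxA -(mulmxA _ a) aX mulmx1 !mulmxDl mul1mx.
    have t3 : Y *m (h0 *m a *m d) *m X = h0 *m d + h0 *m d *m (d - d0) *m h0.
      by rewrite -bh !mulmxA Yb mul1mx mulmxDr mulmx1 !mulmxA.
    have t1 : Y *m 1%:M *m X = 1%:M + h0 *m (d - d0) + (d - d0) *m h0
        + h0 *m (d - d0) *m (d - d0) *m h0.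
      by rewrite mulmx1 mulmxDl mul1mx mulmxDr mulmx1 !mulmxA addrA (addrAC 1%:M).
    have e1 : (d - d0) *m d = - (d0 *m d) by rewrite mulmxBl dd sub0r.
    have e2 : d *m (d - d0) = - (d *m d0) by rewrite mulmxBr dd sub0r.
    have e3 : (d - d0) *m (d - d0) = - (d0 *m d) - d *m d0.
      by rewrite mulmxBr e1 mulmxBl dd0 subr0.
    rewrite !(mulmxBr Y) !(mulmxBl _ _ X) t1 t2 t3 ip.
    rewrite -(mulmxA h0 (d - d0) d) e1 -(mulmxA h0 d (d - d0)) e2.
    rewrite -(mulmxA h0 (d - d0) (d - d0)) e3.
    rewrite (mulmxBr h0 d d0) (mulmxBl d d0 h0) (mulmxBr h0 (- (d0 *m d))) mulmxBl.
    rewrite !mulmxN !mulNmx !mulmxA.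
    move: (h0 *m d0 *m d *m h0) (h0 *m d *m d0 *m h0) => v w.
    move: (h0 *m d) (h0 *m d0) (d *m h0) (d0 *m h0) => w1 w2 w3 w4.
    by apply/matrixP => k l; rewrite !mxE; ring.
  transitivity (b *m (i0 *m p0) *m a); first by rewrite !mulmxA.
  by rewrite -YWX !(mulmxA b) bY mul1mx -(mulmxA _ X) Xa mulmx1.
- rewrite mulmxA -(mulmxA p0) ab mulmxBr mulmxDr mulmx1 mulmxBl mulmxDl pi.
  have -> : p0 *m b = p0.
    have pY : p0 *m Y = p0 by rewrite mulmxDr mulmx1 mulmxA ph mul0mx addr0.
    by rewrite -{1}pY -mulmxA Yb mulmx1.
  have -> : p0 *m a *m i0 = 1%:M.
    have Xi : X *m i0 = i0 by rewrite mulmxDl mul1mx -mulmxA hi mulmx0 addr0.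
    by rewrite -{1}Xi !mulmxA -(mulmxA p0) aX mulmx1.
  by rewrite addrK.
Qed.

(** A square-zero matrix has twice its rank at most [n], so the truncated subtraction in [hdim]
    loses nothing and equals [n] minus twice the rank. *)
Lemma hdim_rank (F : fieldType) n (D D' : 'M[F]_n) :
  D *m D = 0 -> D' *m D' = 0 -> hdim D = hdim D' -> \rank D = \rank D'.
Proof.
move=> /mulmx0_rank_max le /mulmx0_rank_max le'.
rewrite /hdim !mxrank_ker !mxrank_tr -!subnDA => eqs.
move: (congr1 (subn n) eqs); rewrite !subKn // => /eqP.
by rewrite !addnn (inj_eq double_inj) => /eqP.
Qed.

Lemma mxrank_pseudoinverse (T : fieldType) n (d h : 'M[T]_n) :
  h *m d *m h = h -> d *m h *m d = d -> \rank d = \rank h.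
Proof.
move=> hdh dhd; apply/eqP; rewrite eqn_leq; apply/andP; split.
  by rewrite -{1}dhd (leq_trans (mxrankM_maxl _ _)) // mxrankM_maxr.
by rewrite -{1}hdh (leq_trans (mxrankM_maxl _ _)) // mxrankM_maxr.
Qed.

(** Since [h = (h d) h], the rank of [h d] is at least that of [h]; with equal ranks the row space
    of [h d] fills that of [d]. So [d = x h d] for some [x], and [h d h = h] concludes. *)
Lemma contraction_rank_dhd (F : fieldType) n (d h : 'M[F]_n) :
  h *m d *m h = h -> \rank d = \rank h -> d *m h *m d = d.
Proof.
move=> hdh rk.
have /submxP[x dE] : (d <= h *m d)%MS.
  rewrite -(geq_leqif (mxrank_leqif_sup (submxMl h d))) rk -{1}hdh.
  exact: mxrankM_maxl.
by rewrite {1}dE -(mulmxA x) hdh -mulmxA -dE.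
Qed.

Lemma contraction_pdi0 (T : pzRingType) n r (d h : 'M[T]_n)
    (i : 'M[T]_(n, r)) (p : 'M[T]_(r, n)) :
  d *m h *m d = d -> contraction d h i p -> p *m d *m i = 0.
Proof.
by move=> dhd c; rewrite -{1}dhd !mulmxA (contraction_pdh c) !mul0mx.
Qed.

Lemma graded_contraction_exists (F : fieldType) n (d : 'M[F]_n)
    (deg : 'I_n -> int) e :
  d *m d = 0 -> graded_mx deg deg e d ->
  exists r (degr : 'I_r -> int) h i p, [/\ cond_i_at_q d h i p,
    graded_mx deg deg (- e) h, graded_mx deg degr 0 i & graded_mx degr deg 0 p].
Proof.
move=> dd gd.
(* Only a linear equation is asked of [g], namely [d g d = d], so a homogeneous part of any
   pseudo-inverse will do. *)
pose g := hpart deg deg (- e) (pinvmx d).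
have gg : graded_mx deg deg (- e) g by apply: graded_hpart.
have dgd : d *m g *m d = d.
  rewrite -mulmxA /g -(hpart_mulr _ _ _ gd) -(hpart_mull _ _ _ gd) mulmxA.
  by rewrite mulmxKpV // addNr addr0 hpart_id.
pose h1 := g *m d *m g.
have gh1 : graded_mx deg deg (- e) h1.
  by rewrite -[- e]add0r -(addNr e); exact: gradedM (gradedM gg gd) gg.
have h1d : h1 *m d = g *m d by rewrite /h1 -2!mulmxA (mulmxA d) dgd.
have hdh1 : h1 *m d *m h1 = h1.
  by rewrite h1d /h1 !mulmxA -(mulmxA g d g) -(mulmxA g (d *m g) d) dgd mulmxA.
have dhd1 : d *m h1 *m d = d by rewrite /h1 !mulmxA dgd dgd.
(* The passage to [g d g] secured [h d h = h]; this factor adds [h h = 0], and since [d d = 0] it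
   leaves [h d] unchanged. *)
pose h := h1 *m (1%:M - h1 *m d).
have gh1d : graded_mx deg deg 0 (h1 *m d) by rewrite -(addNr e); exact: gradedM gh1 gd.
have gh : graded_mx deg deg (- e) h.
  rewrite -[- e]addr0; apply: (gradedM gh1); apply: gradedB => //; exact: graded1.
have kd : (1%:M - h1 *m d) *m d = d by rewrite mulmxBl mul1mx -mulmxA dd mulmx0 subr0.
have kh : (1%:M - h1 *m d) *m h1 = 0 by rewrite mulmxBl mul1mx hdh1 subrr.
have hh : h *m h = 0 by rewrite /h mulmxA -(mulmxA h1) kh mulmx0 mul0mx.
have hd : h *m d = h1 *m d by rewrite /h -mulmxA kd.
have hdh : h *m d *m h = h by rewrite hd /h mulmxA hdh1.
have dhd : d *m h *m d = d by rewrite -mulmxA hd mulmxA.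
pose P := 1%:M - d *m h - h *m d.
have gP : graded_mx deg deg 0 P.
  apply: gradedB; first apply: gradedB; first exact: graded1.
    by rewrite -(addrN e); exact: gradedM gd gh.
  by rewrite -(addNr e); exact: gradedM gh gd.
have PP : P *m P = P.
  rewrite {2}/P !mulmxBr mulmx1.
  have -> : P *m (d *m h) = 0.
    by rewrite /P mulmxA !mulmxBl mul1mx dhd -(mulmxA h d d) dd mulmx0 mul0mx subr0 subrr.
  have -> : P *m (h *m d) = 0.
    by rewrite /P mulmxA !mulmxBl mul1mx hdh -(mulmxA d h h) hh mulmx0 mul0mx subr0 subrr.
  by rewrite !subr0.
(* A basis taken among the rows of the projector [P] is homogeneous, each row inheriting the degree
   of its index; a general basis of the row space would not be. *)
pose f := maxrankfun P; pose p := rowsub f P.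
pose degr k := deg (f k).
have gp : graded_mx degr deg 0 p by move=> i j ne; rewrite mxE gP.
have Pp : (P <= p)%MS by rewrite eq_maxrowsub.
pose i := hpart deg degr 0 (P *m pinvmx p).
have ip : i *m p = P.
  by rewrite -(hpart_mulr _ _ _ gp) mulmxKpV // addr0 hpart_id.
exists (\rank P), degr, h, i, p; split=> //; last exact: graded_hpart.
split=> //.
have pP : p *m P = p by rewrite /p mul_rowsub_mx PP.
apply: (row_free_inj (maxrowsub_free P)).
by rewrite mul1mx -mulmxA -/f -/p ip.
Qed.

(** * Values at a point of rational functions *)

Lemma tofrac_neq0 (C : fieldType) m (k : 'I_m -> C) (b : {mpoly C[m]}) :
  b.@[k] != 0 -> tofrac b != 0 :> {fraction {mpoly C[m]}}.
Proof. by rewrite tofrac_eq0; apply: contraNneq => ->; rewrite meval0. Qed.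

Lemma tofrac_div_eq (A : idomainType) (a b a' b' : A) :
  tofrac b != 0 -> tofrac b' != 0 ->
  tofrac a / tofrac b = tofrac a' / tofrac b' -> a * b' = a' * b.
Proof.
move=> b0 b'0 /eqP; rewrite eqr_div // -2!tofracM => /eqP e.
by apply/eqP; rewrite -tofrac_eq e.
Qed.

Lemma tofrac_clear (A : idomainType) (a b c : A) : tofrac b != 0 ->
  tofrac (b * c) * (tofrac a / tofrac b) = tofrac (a * c).
Proof. by move=> b0; rewrite !tofracM mulrCA [X in _ * X]mulrAC mulfV // mul1r. Qed.

Lemma frac_val_uniq (C : fieldType) m (k : 'I_m -> C) x v w :
  frac_val k x v -> frac_val k x w -> v = w.
Proof.
case=> a [b [bk [-> ->]]] [a' [b' [b'k [eqx ->]]]].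
have := tofrac_div_eq (tofrac_neq0 bk) (tofrac_neq0 b'k) eqx.
move=> /(congr1 (meval k)); rewrite !mevalM => e.
by apply/eqP; rewrite eqr_div // e.
Qed.

Lemma frac_val_tofrac (C : fieldType) m (k : 'I_m -> C) (a : {mpoly C[m]}) :
  frac_val k (tofrac a) a.@[k].
Proof. by exists a, 1; rewrite meval1 tofrac1 !divr1 oner_eq0. Qed.

Lemma frac_val0 (C : fieldType) m (k : 'I_m -> C) : frac_val k 0 0.
Proof. by have := frac_val_tofrac k 0; rewrite meval0 tofrac0. Qed.

Lemma frac_val1 (C : fieldType) m (k : 'I_m -> C) : frac_val k 1 1.
Proof. by have := frac_val_tofrac k 1; rewrite meval1 tofrac1. Qed.

Lemma frac_valD (C : fieldType) m (k : 'I_m -> C) x y v w :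
  frac_val k x v -> frac_val k y w -> frac_val k (x + y) (v + w).
Proof.
case=> a [b [bk [-> ->]]] [a' [b' [b'k [-> ->]]]].
exists (a * b' + a' * b), (b * b'); rewrite mevalM mulf_neq0 //; split=> //.
rewrite !mevalD !mevalM tofracD !tofracM.
have b0 := tofrac_neq0 bk; have b'0 := tofrac_neq0 b'k.
by rewrite (addf_div _ _ b0 b'0) (addf_div _ _ bk b'k).
Qed.

Lemma frac_valN (C : fieldType) m (k : 'I_m -> C) x v :
  frac_val k x v -> frac_val k (- x) (- v).
Proof.
case=> a [b [bk [-> ->]]]; exists (- a), b.
by rewrite tofracN mevalN !mulNr.
Qed.

Lemma frac_valM (C : fieldType) m (k : 'I_m -> C) x y v w :
  frac_val k x v -> frac_val k y w -> frac_val k (x * y) (v * w).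
Proof.
case=> a [b [bk [-> ->]]] [a' [b' [b'k [-> ->]]]].
exists (a * a'), (b * b'); rewrite !mevalM mulf_neq0 //; split=> //.
by split; rewrite ?tofracM mulf_div.
Qed.

Lemma frac_valV (C : fieldType) m (k : 'I_m -> C) x v :
  v != 0 -> frac_val k x v -> frac_val k x^-1 v^-1.
Proof.
move=> v0 [a [b [bk [-> vE]]]]; exists b, a; rewrite vE !invf_div; split=> //.
by apply: contraNneq v0 => a0; rewrite vE a0 mul0r.
Qed.

Lemma frac_val_sum (C : fieldType) m (k : 'I_m -> C) (I : Type) (r : seq I)
    (P : pred I) x v : (forall i, P i -> frac_val k (x i) (v i)) ->
  frac_val k (\sum_(i <- r | P i) x i) (\sum_(i <- r | P i) v i).
Proof.
move=> xv; apply: (big_ind2 (frac_val k)) => //; first exact: frac_val0.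
by move=> *; apply: frac_valD.
Qed.

Lemma frac_val_prod (C : fieldType) m (k : 'I_m -> C) (I : Type) (r : seq I)
    (P : pred I) x v : (forall i, P i -> frac_val k (x i) (v i)) ->
  frac_val k (\prod_(i <- r | P i) x i) (\prod_(i <- r | P i) v i).
Proof.
move=> xv; apply: (big_ind2 (frac_val k)) => //; first exact: frac_val1.
by move=> *; apply: frac_valM.
Qed.

Lemma frac_val_sign (C : fieldType) m (k : 'I_m -> C) s :
  frac_val k ((-1) ^+ s) ((-1) ^+ s).
Proof.
elim: s => [|s IH]; first by rewrite !expr0; apply: frac_val1.
by rewrite !exprS; apply: frac_valM IH; apply: frac_valN; apply: frac_val1.
Qed.

Lemma mx_val_uniq (C : fieldType) m (k : 'I_m -> C) a b A (A0 A1 : 'M[C]_(a, b)) :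
  mx_val k A A0 -> mx_val k A A1 -> A0 = A1.
Proof. by move=> H0 H1; apply/matrixP => i j; apply: frac_val_uniq (H0 i j) (H1 i j). Qed.

Lemma mx_val_tofrac (C : fieldType) m (k : 'I_m -> C) a b
    (A : 'M[{mpoly C[m]}]_(a, b)) :
  mx_val k (map_mx (fun x => tofrac x) A) (evalmx k A).
Proof. by move=> i j; rewrite !mxE; apply: frac_val_tofrac. Qed.

Definition constf (C : fieldType) m : {rmorphism C -> {fraction {mpoly C[m]}}} :=
  @FracField.tofrac _ \o @mpolyC m C.

Lemma mx_val_const (C : fieldType) m (k : 'I_m -> C) a b (A : 'M[C]_(a, b)) :
  mx_val k (map_mx (constf C m) A) A.
Proof.
move=> i j; rewrite mxE; have := frac_val_tofrac k (A i j)%:MP.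
by rewrite mevalC.
Qed.

Lemma mx_val0 (C : fieldType) m (k : 'I_m -> C) a b :
  mx_val k 0 (0 : 'M[C]_(a, b)).
Proof. by move=> i j; rewrite !mxE; apply: frac_val0. Qed.

Lemma mx_val1 (C : fieldType) m (k : 'I_m -> C) a :
  mx_val k 1%:M (1%:M : 'M[C]_a).
Proof.
move=> i j; rewrite !mxE; case: eqP => _; [exact: frac_val1|exact: frac_val0].
Qed.

Lemma mx_valD (C : fieldType) m (k : 'I_m -> C) a b A B (A0 B0 : 'M[C]_(a, b)) :
  mx_val k A A0 -> mx_val k B B0 -> mx_val k (A + B) (A0 + B0).
Proof. by move=> HA HB i j; rewrite !mxE; apply: frac_valD. Qed.

Lemma mx_valB (C : fieldType) m (k : 'I_m -> C) a b A B (A0 B0 : 'M[C]_(a, b)) :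
  mx_val k A A0 -> mx_val k B B0 -> mx_val k (A - B) (A0 - B0).
Proof. by move=> HA HB i j; rewrite !mxE; apply: frac_valD => //; apply: frac_valN. Qed.

Lemma mx_valM (C : fieldType) m (k : 'I_m -> C) a b c A B
    (A0 : 'M[C]_(a, b)) (B0 : 'M[C]_(b, c)) :
  mx_val k A A0 -> mx_val k B B0 -> mx_val k (A *m B) (A0 *m B0).
Proof.
move=> HA HB i j; rewrite !mxE; apply: frac_val_sum => l _; exact: frac_valM.
Qed.

Lemma mx_valZ (C : fieldType) m (k : 'I_m -> C) a b x v A (A0 : 'M[C]_(a, b)) :
  frac_val k x v -> mx_val k A A0 -> mx_val k (x *: A) (v *: A0).
Proof. by move=> xv HA i j; rewrite !mxE; apply: frac_valM. Qed.

Lemma frac_val_det (C : fieldType) m (k : 'I_m -> C) a A (A0 : 'M[C]_a) :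
  mx_val k A A0 -> frac_val k (\det A) (\det A0).
Proof.
move=> HA; apply: frac_val_sum => s _; apply: frac_valM.
  exact: frac_val_sign.
by apply: frac_val_prod.
Qed.

(** Determinant and cofactors are polynomial in the entries, and the only new denominator, the
    determinant, is nonzero at [k]. *)
Lemma mx_val_invmx (C : fieldType) m (k : 'I_m -> C) a A (A0 : 'M[C]_a) :
  mx_val k A A0 -> A0 \in unitmx ->
  A \in unitmx /\ mx_val k (invmx A) (invmx A0).
Proof.
move=> HA UA0; have detv := frac_val_det HA.
have d0 : \det A0 != 0 by rewrite -unitfE -unitmxE.
have UA : A \in unitmx.
  rewrite unitmxE unitfE; apply: contraNneq d0 => dA0; apply/eqP.
  by apply: (frac_val_uniq detv); rewrite dA0; apply: frac_val0.
split=> //; rewrite /invmx UA UA0; apply: mx_valZ; first exact: frac_valV.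
move=> i j; rewrite !mxE; apply: frac_valM; first exact: frac_val_sign.
by apply: frac_val_det => s t; rewrite !mxE.
Qed.

Lemma mx_val_clear (C : fieldType) m (q : 'I_m -> C) a b
    (A : 'M[{fraction {mpoly C[m]}}]_(a, b)) (A0 : 'M[C]_(a, b)) :
  mx_val q A A0 -> exists c (B : 'M[{mpoly C[m]}]_(a, b)),
    c.@[q] != 0 /\ map_mx (fun x => tofrac x) B = tofrac c *: A.
Proof.
move=> HA.
have /choice[nd ndE] : forall ij : 'I_a * 'I_b, exists nd : {mpoly C[m]} * {mpoly C[m]},
    nd.2.@[q] != 0 /\ A ij.1 ij.2 = tofrac nd.1 / tofrac nd.2.
  by move=> [i j]; have [x [y [yq [xy _]]]] := HA i j; exists (x, y).
exists (\prod_ij (nd ij).2).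
exists (\matrix_(i, j) ((nd (i, j)).1 * \prod_(ij | ij != (i, j)) (nd ij).2)).
split.
  by rewrite rmorph_prod; apply/prodf_neq0 => ij _; have [] := ndE ij.
apply/matrixP => i j; have [nq] := ndE (i, j); rewrite !mxE /= => ->.
by rewrite [in RHS](bigD1 (i, j)) //= (tofrac_clear _ _ (tofrac_neq0 nq)).
Qed.

Lemma mx_val_nbhd (C : fieldType) m (q : 'I_m -> C) a b
    (A : 'M[{fraction {mpoly C[m]}}]_(a, b)) (A0 : 'M[C]_(a, b)) :
  mx_val q A A0 -> exists2 g : {mpoly C[m]}, g.@[q] != 0 &
    forall k, g.@[k] != 0 -> exists Ak, mx_val k A Ak.
Proof.
case/mx_val_clear => c [B [cq BE]]; exists c => // k ck.
exists (c.@[k]^-1 *: evalmx k B).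
have -> : A = (tofrac c)^-1 *: (tofrac c *: A).
  by rewrite scalerA mulVf ?scale1r // (tofrac_neq0 ck).
rewrite -BE; apply: mx_valZ; last exact: mx_val_tofrac.
by apply: frac_valV => //; apply: frac_val_tofrac.
Qed.

Lemma contraction_val (C : fieldType) m (k : 'I_m -> C) n r D h
    (i : 'M[_]_(n, r)) p (dk hk : 'M[C]_n) (ik : 'M[C]_(n, r)) pk :
  mx_val k D dk -> mx_val k h hk -> mx_val k i ik -> mx_val k p pk ->
  contraction D h i p -> contraction dk hk ik pk.
Proof.
move=> Vd Vh Vi Vp [hh hdh ip pi]; split.
- by apply: mx_val_uniq (mx_valM Vh Vh) _; rewrite hh; apply: mx_val0.
- by apply: mx_val_uniq (mx_valM (mx_valM Vh Vd) Vh) _; rewrite hdh.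
- apply: mx_val_uniq (mx_valM Vi Vp) _; rewrite ip.
  apply: mx_valB; last exact: mx_valM.
  by apply: mx_valB; [exact: mx_val1 | exact: mx_valM].
- by apply: mx_val_uniq (mx_valM Vp Vi) _; rewrite pi; apply: mx_val1.
Qed.

(** [X] and [Y] take the value [1] at [q], so they are invertible with inverses regular at [q], and
    these leave the prescribed values unchanged. The factor [a] is returned so that the rank of [h]
    near [q] can be compared with that of [h0]. *)
Lemma contraction_lift (C : fieldType) m (q : 'I_m -> C) n r D
    (d0 h0 : 'M[C]_n) (i0 : 'M[C]_(n, r)) (p0 : 'M[C]_(r, n))
    (deg : 'I_n -> int) (degr : 'I_r -> int) e :
  mx_val q D d0 -> D *m D = 0 -> contraction d0 h0 i0 p0 ->
  graded_mx deg deg e D -> graded_mx deg deg (- e) h0 ->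
  graded_mx deg degr 0 i0 -> graded_mx degr deg 0 p0 ->
  exists h i p a,
  [/\ contraction D h i p,
      [/\ mx_val q h h0, mx_val q i i0 & mx_val q p p0],
      [/\ graded_mx deg deg (- e) h, graded_mx deg degr 0 i & graded_mx degr deg 0 p],
      mx_val q a 1%:M & h = map_mx (constf C m) h0 *m a].
Proof.
move=> Vd DD c gD gh gi gp.
have d00 : d0 *m d0 = 0.
  by apply: mx_val_uniq (mx_valM Vd Vd) _; rewrite DD; apply: mx_val0.
have gd0 : graded_mx deg deg e d0.
  move=> i j ne; apply: (frac_val_uniq (Vd i j)); rewrite gD //; exact: frac_val0.
have gc a b (da : 'I_a -> int) (db : 'I_b -> int) s (A : 'M[C]_(a, b)) :
    graded_mx da db s A -> graded_mx da db s (map_mx (constf C m) A).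
  exact: graded_map.
have Vc a b (A : 'M[C]_(a, b)) := mx_val_const q A.
set d0F := map_mx (constf C m) d0; set h0F := map_mx (constf C m) h0.
set X := 1%:M + (D - d0F) *m h0F; set Y := 1%:M + h0F *m (D - d0F).
have Vdd : mx_val q (D - d0F) 0 by rewrite -(subrr d0); apply: mx_valB => //; apply: Vc.
have VX : mx_val q X 1%:M.
  rewrite -[1%:M]addr0 -(mul0mx _ h0); apply: mx_valD; first exact: mx_val1.
  exact: mx_valM Vdd (Vc _ _ _).
have VY : mx_val q Y 1%:M.
  rewrite -[1%:M]addr0 -(mulmx0 _ h0); apply: mx_valD; first exact: mx_val1.
  exact: mx_valM (Vc _ _ _) Vdd.
have [UX] := mx_val_invmx VX (unitmx1 _ _); rewrite invmx1 => VXi.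
have [UY] := mx_val_invmx VY (unitmx1 _ _); rewrite invmx1 => VYi.
have gdd : graded_mx deg deg e (D - d0F) by apply: gradedB => //; apply: gc.
have gX : graded_mx deg deg 0 X.
  apply: gradedD; first exact: graded1.
  by rewrite -(addrN e); apply: gradedM gdd (gc _ _ _ _ _ _ gh).
have gY : graded_mx deg deg 0 Y.
  apply: gradedD; first exact: graded1.
  by rewrite -(addNr e); apply: gradedM (gc _ _ _ _ _ _ gh) gdd.
exists (h0F *m invmx X), (invmx Y *m map_mx (constf C m) i0),
  (map_mx (constf C m) p0 *m invmx X), (invmx X).
split; [|split|split|exact: VXi|by []].
- apply: (contraction_perturb (d0 := d0F)) => //.
  + by rewrite -map_mxM d00 map_mx0.
  + exact: contraction_map.
  + exact: (mulVmx UX).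
  + exact: (mulmxV UX).
  + exact: (mulVmx UY).
  + exact: (mulmxV UY).
- by have := mx_valM (Vc _ _ h0) VXi; rewrite mulmx1.
- by have := mx_valM VYi (Vc _ _ i0); rewrite mul1mx.
- by have := mx_valM (Vc _ _ p0) VXi; rewrite mulmx1.
- by rewrite -[- e]addr0; apply: gradedM (gc _ _ _ _ _ _ gh) (graded_invmx UX gX).
- by rewrite -[0]addr0; apply: gradedM (graded_invmx UY gY) (gc _ _ _ _ _ _ gi).
- by rewrite -[0]addr0; apply: gradedM (gc _ _ _ _ _ _ gp) (graded_invmx UX gX).
Qed.

(** For [x = a / b] the polynomial [a g b] vanishes on all of [Q = 0], the factors [g] and [b]
    covering the points where nothing is known about [x]. Hence [a g b = Q u], and the quotient has
    denominator [b g b], nonzero at [q]. *)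
Lemma frac_val_divide (C : numClosedFieldType) m (q : 'I_m -> C)
    (Q g : {mpoly C[m]}) x v :
  mirreducible Q -> frac_val q x v -> g.@[q] != 0 ->
  (forall k w, Q.@[k] = 0 -> g.@[k] != 0 -> frac_val k x w -> w = 0) ->
  exists y w, frac_val q y w /\ x = tofrac Q * y.
Proof.
move=> irr [a [b [bq [xE _]]]] gq xQ.
have [k Qk|u uE] := irreducible_nullstellensatz (f := a * (g * b)) irr.
  rewrite !mevalM; have [->|gk] := eqVneq g.@[k] 0; first by rewrite mul0r mulr0.
  have [->|bk] := eqVneq b.@[k] 0; first by rewrite !mulr0.
  have /eqP : a.@[k] / b.@[k] = 0 by apply: (xQ k) => //; exists a, b.
  by rewrite mulf_eq0 invr_eq0 (negPf bk) orbF => /eqP ->; rewrite mul0r.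
have dq : (b * (g * b)).@[q] != 0 by rewrite !mevalM !mulf_neq0.
exists (tofrac u / tofrac (b * (g * b))), (u.@[q] / (b * (g * b)).@[q]); split.
  by exists u, (b * (g * b)).
have gb : tofrac (g * b) != 0 :> {fraction {mpoly C[m]}}.
  by apply: (tofrac_neq0 (k := q)); rewrite mevalM mulf_neq0.
rewrite xE mulrA -tofracM -uE !tofracM -mulf_div -tofracM divff // mulr1 //.
Qed.

(** * The reduced differential *)

(** From [p d = x d' p] and [d i = x i d'], the factor [1/x] cancels in [H d + d H], leaving
    [h d + d h + i p = 1]. *)
Lemma contraction_total (F : fieldType) n r (d h : 'M[F]_n) (i : 'M[F]_(n, r))
    (p : 'M[F]_(r, n)) (d' h' : 'M[F]_r) (x : F) (H := h + x^-1 *: (i *m h' *m p)) :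
  x != 0 -> d *m d = 0 -> contraction d h i p -> p *m d *m i = x *: d' ->
  h' *m h' = 0 -> h' *m d' + d' *m h' = 1%:M ->
  H *m H = 0 /\ H *m d + d *m H = 1%:M.
Proof.
move=> x0 dd c pdi h'h' hd'.
have hi := contraction_hi c; have ph := contraction_ph c.
have pdE := contraction_pd_split dd c; have diE := contraction_di_split dd c.
case: c => hh _ ip pi; rewrite /H; split.
  have hW : h *m (x^-1 *: (i *m h' *m p)) = 0.
    by rewrite -scalemxAr !mulmxA hi !mul0mx scaler0.
  have Wh : x^-1 *: (i *m h' *m p) *m h = 0.
    by rewrite -scalemxAl -(mulmxA _ p) ph mulmx0 scaler0.
  have WW : i *m h' *m p *m (i *m h' *m p) = 0.
    rewrite -!mulmxA (mulmxA p i) pi mul1mx (mulmxA h' h') h'h'.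
    by rewrite mul0mx mulmx0.
  by rewrite mulmxDl !mulmxDr hh hW Wh -scalemxAl -scalemxAr WW !scaler0 !addr0.
have e1 : x^-1 *: (i *m h' *m p) *m d = i *m (h' *m d') *m p.
  rewrite -scalemxAl -(mulmxA _ p) -pdE pdi -!mulmxA -!scalemxAl -!scalemxAr.
  by rewrite scalerA mulVf // scale1r.
have e2 : d *m (x^-1 *: (i *m h' *m p)) = i *m (d' *m h') *m p.
  rewrite -scalemxAr !mulmxA -diE pdi -!scalemxAr -!scalemxAl.
  by rewrite scalerA mulVf // scale1r.
rewrite mulmxDl mulmxDr e1 e2 addrACA -mulmxDl -mulmxDr hd' mulmx1 ip.
by rewrite [LHS]addrC addrA !subrK.
Qed.

(** * Directional derivatives and exactness of the reduced differential *)

Lemma dirderivM (C : comNzRingType) m (xi q : 'I_m -> C) (P S : {mpoly C[m]}) :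
  dirderiv xi q (P * S) = dirderiv xi q P * S.@[q] + P.@[q] * dirderiv xi q S.
Proof.
rewrite /dirderiv mulr_suml mulr_sumr -big_split; apply: eq_bigr => j _ /=.
by rewrite mderivM mevalD !mevalM; ring.
Qed.

Lemma dirderiv_sum (C : comNzRingType) m (xi q : 'I_m -> C) (I : finType)
    (P : I -> {mpoly C[m]}) :
  dirderiv xi q (\sum_i P i) = \sum_i dirderiv xi q (P i).
Proof.
rewrite /dirderiv exchange_big; apply: eq_bigr => j _.
by rewrite (raddf_sum (mderiv j)) (raddf_sum (meval q)) mulr_sumr.
Qed.

Lemma dirderiv_mxM (C : comNzRingType) m (xi q : 'I_m -> C) a b c
    (A : 'M[{mpoly C[m]}]_(a, b)) (B : 'M[{mpoly C[m]}]_(b, c)) :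
  dirderiv_mx xi q (A *m B) =
  dirderiv_mx xi q A *m evalmx q B + evalmx q A *m dirderiv_mx xi q B.
Proof.
apply/matrixP => i j; rewrite !mxE dirderiv_sum -big_split.
by apply: eq_bigr => l _; rewrite !mxE dirderivM.
Qed.

Lemma dirderiv_mxZ (C : comNzRingType) m (xi q : 'I_m -> C) a b x
    (A : 'M[{mpoly C[m]}]_(a, b)) :
  dirderiv_mx xi q (x *: A) =
  dirderiv xi q x *: evalmx q A + x.@[q] *: dirderiv_mx xi q A.
Proof. by apply/matrixP => i j; rewrite !mxE dirderivM. Qed.

Lemma dirderiv_mx0 (C : comNzRingType) m (xi q : 'I_m -> C) a b :
  dirderiv_mx xi q (0 : 'M_(a, b)) = 0.
Proof.
apply/matrixP => i j; rewrite !mxE /dirderiv big1 // => l _.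
by rewrite mderiv0 meval0 mulr0.
Qed.

Lemma evalmxM (C : comNzRingType) m (k : 'I_m -> C) a b c
    (A : 'M[{mpoly C[m]}]_(a, b)) (B : 'M[{mpoly C[m]}]_(b, c)) :
  evalmx k (A *m B) = evalmx k A *m evalmx k B.
Proof. exact: (map_mxM (meval k)). Qed.

Lemma evalmx0 (C : comNzRingType) m (k : 'I_m -> C) a b :
  evalmx k (0 : 'M_(a, b)) = 0.
Proof. exact: (map_mx0 (meval k)). Qed.

(** In any contraction of [d] with [d h d = d], the columns of [i] are cycles, hence boundaries,
    hence killed by [p]. So [p i = 1] is zero, and the homology part can be taken empty. *)
Lemma contraction_acyclic (F : fieldType) n (d : 'M[F]_n) (deg : 'I_n -> int) e :
  d *m d = 0 -> graded_mx deg deg e d ->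
  (forall x : 'cV_n, d *m x = 0 -> exists y, x = d *m y) ->
  exists h, [/\ contraction d h (0 : 'M_(n, 0)) (0 : 'M_(0, n))
    & graded_mx deg deg (- e) h].
Proof.
move=> dd gd ex.
have [r [degr [h [i [p [[hh hdh ip pi dhd] gh _ _]]]]]] :=
  graded_contraction_exists dd gd.
exists h; split=> //; split=> //; last by rewrite [RHS]flatmx0 [LHS]flatmx0.
have c : contraction d h i p by [].
have r0 : 1%:M = 0 :> 'M[F]_r.
  rewrite -pi; apply/matrixP => s j.
  have [|y yE] := ex (i *m delta_mx j 0).
    by rewrite mulmxA (contraction_di dd dhd c) mul0mx.
  have /matrixP/(_ s 0) : col j (p *m i) = 0.
    by rewrite colE -mulmxA yE mulmxA (contraction_pd dd dhd c) mul0mx.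
  by rewrite !mxE.
by rewrite mul0mx -ip -(mulmx1 i) r0 mulmx0 mul0mx.
Qed.

Lemma mx_val_divide (C : numClosedFieldType) m (q : 'I_m -> C) a b
    (Q g : {mpoly C[m]}) (A : 'M[{fraction {mpoly C[m]}}]_(a, b)) A0 :
  mirreducible Q -> mx_val q A A0 -> g.@[q] != 0 ->
  (forall k Ak, Q.@[k] = 0 -> g.@[k] != 0 -> mx_val k A Ak -> Ak = 0) ->
  exists B B0, mx_val q B B0 /\ A = tofrac Q *: B.
Proof.
move=> irr VA gq AQ.
have [gA gAq VAk] := mx_val_nbhd VA.
have /choice[yw ywE] : forall ij : 'I_a * 'I_b, exists yw : {fraction {mpoly C[m]}} * C,
    frac_val q yw.1 yw.2 /\ A ij.1 ij.2 = tofrac Q * yw.1.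
  move=> [i j]; have [||y [w [yw Ay]]] := frac_val_divide (g := gA * g) irr (VA i j).
  - by rewrite mevalM mulf_neq0.
  - move=> k w Qk; rewrite mevalM mulf_eq0 negb_or => /andP[gAk gk] Vw.
    have [Ak Vk] := VAk k gAk.
    by rewrite (frac_val_uniq Vw (Vk i j)) (AQ k Ak Qk gk Vk) mxE.
  - by exists (y, w).
exists (\matrix_(i, j) (yw (i, j)).1), (\matrix_(i, j) (yw (i, j)).2); split.
  by move=> i j; rewrite !mxE; have [] := ywE (i, j).
by apply/matrixP => i j; rewrite !mxE; have [_] := ywE (i, j).
Qed.

Lemma mx_val_clear_eval (C : fieldType) m (q : 'I_m -> C) a b
    (A : 'M[{fraction {mpoly C[m]}}]_(a, b)) (A0 : 'M[C]_(a, b)) :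
  mx_val q A A0 -> exists c (B : 'M[{mpoly C[m]}]_(a, b)),
    [/\ c.@[q] != 0, map_mx (fun x => tofrac x) B = tofrac c *: A
      & evalmx q B = c.@[q] *: A0].
Proof.
move=> VA; have [c [B [cq BE]]] := mx_val_clear VA; exists c, B; split=> //.
apply: mx_val_uniq (mx_val_tofrac q B) _; rewrite BE; apply: mx_valZ => //.
exact: frac_val_tofrac.
Qed.

(* Leibniz along [xi] of [p d i = Q d'] at [q], where [p0 d0 = 0], [d0 i0 = 0]
   and [Q] vanish. *)
Lemma dirderiv_reduced (C : fieldType) m (q xi : 'I_m -> C) n r
    (d : 'M[{mpoly C[m]}]_n) (Q : {mpoly C[m]}) (i : 'M_(n, r)) (p : 'M_(r, n))
    (d' : 'M_r) i0 p0 d'0 (d0 := evalmx q d) :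
  mx_val q i i0 -> mx_val q p p0 -> mx_val q d' d'0 ->
  p *m map_mx (fun x => tofrac x) d *m i = tofrac Q *: d' ->
  p0 *m d0 = 0 -> d0 *m i0 = 0 -> Q.@[q] = 0 ->
  p0 *m dirderiv_mx xi q d *m i0 = dirderiv xi q Q *: d'0.
Proof.
move=> Vi Vp Vd' pdi pd di Qq.
have [c1 [P [c1q PE Pq]]] := mx_val_clear_eval Vp.
have [c2 [I [c2q IE Iq]]] := mx_val_clear_eval Vi.
have [c3 [U [c3q UE Uq]]] := mx_val_clear_eval Vd'.
have tofrac_mx_inj a b : injective (map_mx (fun x : {mpoly C[m]} => tofrac x) : 'M_(a, b) -> _).
  move=> A B AB; apply/matrixP => s t; apply/eqP; rewrite -tofrac_eq; apply/eqP.
  by have := congr1 (fun M : 'M_(a, b) => M s t) AB; rewrite !mxE.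
(* Derivatives are defined on polynomials, so denominators are cleared. Their own derivatives drop
   out, being multiplied by [P d I] or by [Q], both zero at [q]. *)
have polyE : c3 *: (P *m d *m I) = (c1 * c2 * Q) *: U.
  apply: tofrac_mx_inj; rewrite !map_mxZ !map_mxM /= PE IE UE.
  rewrite -!scalemxAl -!scalemxAr pdi !scalerA !tofracM.
  by congr (_ *: _); ring.
have Pd0 : evalmx q (P *m d) = 0 by rewrite evalmxM Pq -scalemxAl pd scaler0.
have L : dirderiv_mx xi q (c3 *: (P *m d *m I)) =
    (c3.@[q] * (c1.@[q] * c2.@[q])) *: (p0 *m dirderiv_mx xi q d *m i0).
  rewrite dirderiv_mxZ (evalmxM _ (P *m d)) Pd0 mul0mx scaler0 add0r.
  rewrite dirderiv_mxM Pd0 mul0mx addr0 dirderiv_mxM mulmxDl.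
  rewrite -[_ *m evalmx q d *m _]mulmxA Iq -scalemxAr di scaler0 mulmx0 add0r.
  by rewrite Pq -!scalemxAl -scalemxAr !scalerA mulrA.
have R : dirderiv_mx xi q ((c1 * c2 * Q) *: U) =
    (c3.@[q] * (c1.@[q] * c2.@[q])) *: (dirderiv xi q Q *: d'0).
  rewrite dirderiv_mxZ mevalM Qq mulr0 scale0r addr0 Uq dirderivM Qq mulr0 add0r.
  by rewrite mevalM !scalerA; congr (_ *: _); ring.
have cq : c3.@[q] * (c1.@[q] * c2.@[q]) != 0 by rewrite !mulf_neq0.
by apply: (scalerI cq); rewrite -L -R polyE.
Qed.

Lemma dirderiv_anticommute (C : fieldType) m (q xi : 'I_m -> C) n
    (d : 'M[{mpoly C[m]}]_n) : d *m d = 0 ->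
  dirderiv_mx xi q d *m evalmx q d = - (evalmx q d *m dirderiv_mx xi q d).
Proof.
move=> dd; apply/eqP; rewrite -addr_eq0 -dirderiv_mxM dd.
by rewrite dirderiv_mx0.
Qed.

(** [i0] and [p0] identify the homology of [d0] with column vectors of length [r]; under this
    identification [d1] induces [p0 d1 i0]. A nonzero scalar does not affect exactness. *)
Lemma reduced_acyclic (C : fieldType) n r (d0 d1 h0 : 'M[C]_n) (i0 : 'M_(n, r))
    (p0 : 'M_(r, n)) (d'0 : 'M_r) (x : C) :
  d0 *m d0 = 0 -> d1 *m d0 = - (d0 *m d1) -> d0 *m h0 *m d0 = d0 ->
  contraction d0 h0 i0 p0 -> induced_exact d0 d1 -> x != 0 ->
  p0 *m d1 *m i0 = x *: d'0 ->
  forall v : 'cV_r, d'0 *m v = 0 -> exists w, v = d'0 *m w.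
Proof.
move=> dd d10 dhd c ex x0 pdi v d'v.
have di := contraction_di dd dhd c; have pd := contraction_pd dd dhd c.
case: c => _ _ ip pi.
have dX : d0 *m (i0 *m v) = 0 by rewrite mulmxA di mul0mx.
have [|y [w [dy vE]]] := ex _ dX.
  exists (h0 *m (d1 *m (i0 *m v))).
  have : i0 *m p0 *m (d1 *m (i0 *m v)) = 0.
    by rewrite -mulmxA (mulmxA p0 d1) (mulmxA _ i0) pdi -scalemxAl d'v scaler0 mulmx0.
  rewrite ip !mulmxBl mul1mx -(mulmxA h0) (mulmxA d0 d1).
  have -> : d0 *m d1 = - (d1 *m d0) by rewrite d10 opprK.
  rewrite mulNmx -(mulmxA d1) dX mulmx0 oppr0 mulmx0 subr0 => /eqP.
  by rewrite subr_eq0 -mulmxA => /eqP.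
exists (x *: (p0 *m y)).
have yE : y = i0 *m (p0 *m y) + d0 *m (h0 *m y).
  rewrite (mulmxA i0) ip !mulmxBl mul1mx -!mulmxA dy mulmx0 subr0.
  by rewrite subrK.
rewrite -scalemxAr scalemxAl -pdi -[LHS]mul1mx -pi -[LHS]mulmxA vE mulmxDr.
rewrite (mulmxA p0 d0) pd mul0mx addr0 {1}yE !mulmxDr (mulmxA d1 d0) d10.
by rewrite mulNmx mulmxN -!mulmxA (mulmxA p0 d0) pd mul0mx oppr0 addr0.
Qed.

(** * Assembly at a regular homology point *)

Lemma graded_contraction_conclusion (C : numClosedFieldType) m n r
  (d : 'M[{mpoly C[m]}]_n) (Q : {mpoly C[m]}) (q : 'I_m -> C)
  (deg : 'I_n -> int) (degr : 'I_r -> int) e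
  (h0 : 'M[C]_n) (i0 : 'M[C]_(n, r)) (p0 : 'M[C]_(r, n)) :
  d *m d = 0 ->
  graded_mx deg deg e d -> mirreducible Q ->
  regular_homology_point d Q q ->
  cond_i_at_q (evalmx q d) h0 i0 p0 ->
  graded_mx deg deg (- e) h0 -> graded_mx deg degr 0 i0 ->
  graded_mx degr deg 0 p0 ->
  exists h i p d' h', main_conclusion d Q q deg degr e h i p d' h' h0 i0 p0.
Proof.
move=> dd gd irr [Qq _ [g [gq hdimE]] [xi [Qxi ex]]] cq gh0 gi0 gp0.
set d0 := evalmx q d in cq hdimE ex.
have c0 : contraction d0 h0 i0 p0 by case: cq.
have dhd0 : d0 *m h0 *m d0 = d0 by case: cq.
have evdd k : evalmx k d *m evalmx k d = 0 by rewrite -evalmxM dd evalmx0.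
set dF := map_mx (fun x => tofrac x) d.
have dFdF : dF *m dF = 0.
  by rewrite /dF -(map_mxM (@FracField.tofrac _)) dd (map_mx0 (@FracField.tofrac _)).
have gdF : graded_mx deg deg e dF by move=> s t ne; rewrite mxE gd // tofrac0.
have [h [i [p [a [c [Vh Vi Vp] [gh gi gp] Va hE]]]]] :=
  contraction_lift (mx_val_tofrac q d) dFdF c0 gdF gh0 gi0 gp0.
have [_] := mx_val_invmx Va (unitmx1 _ _); rewrite invmx1 => Vai.
have Ua : a \in unitmx by case: (mx_val_invmx Va (unitmx1 _ _)).
have [gI gIq VI] := mx_val_nbhd Vi.
have [gP gPq VP] := mx_val_nbhd Vp.
have [gA gAq VA] := mx_val_nbhd Va.
have [gB gBq VB] := mx_val_nbhd Vai.
have Vpdi : mx_val q (p *m dF *m i) (p0 *m d0 *m i0).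
  by apply: mx_valM => //; apply: mx_valM => //; apply: mx_val_tofrac.
have [||d' [d'0 [Vd' pdiE]]] :=
    mx_val_divide (g := g * (gI * (gP * (gA * gB)))) irr Vpdi.
- by rewrite !mevalM !mulf_neq0.
- move=> k M Qk; rewrite !mevalM !mulf_eq0 !negb_or.
  case/and5P => gk /VI[ik Vik] /VP[pk Vpk] /VA[ak Vak] /VB[bk Vbk] VM.
  have Vdk := mx_val_tofrac k d.
  have Vhk : mx_val k h (h0 *m ak) by rewrite hE; apply: mx_valM => //; apply: mx_val_const.
  have ck := contraction_val Vdk Vhk Vik Vpk c.
  (* Both [a] and its inverse have values at [k], so [ak] is invertible and [h0 ak] has the rank of
     [h0], which is that of [d0]. *)
  have ab : ak *m bk = 1%:M.
    by apply: (mx_val_uniq (mx_valM Vak Vbk)); rewrite (mulmxV Ua); apply: mx_val1.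
  have [Uak _] := mulmx1_unit ab.
  have rk : \rank (evalmx k d) = \rank (h0 *m ak).
    rewrite mxrankMfree ?row_free_unit // (hdim_rank (evdd k) (evdd q)); last exact: hdimE.
    by apply: mxrank_pseudoinverse => //; case: c0.
  have [_ hdh _ _] := ck.
  rewrite -(contraction_pdi0 (contraction_rank_dhd hdh rk) ck).
  by apply: mx_val_uniq VM _; apply: mx_valM => //; apply: mx_valM.
have Q0 : tofrac Q != 0 :> {fraction {mpoly C[m]}} by rewrite tofrac_eq0; case: irr.
have d'd' : d' *m d' = 0.
  apply: (scalerI Q0); apply: (scalerI Q0); rewrite !scaler0.
  by rewrite scalemxAl scalemxAr -pdiE (contraction_square0 dFdF c).
have gd' : graded_mx degr degr e d'.
  have gpdi : graded_mx degr degr e (p *m dF *m i).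
    by rewrite -[e]addr0 -[e]add0r; apply: gradedM gi; apply: gradedM gdF.
  move=> s t /gpdi; rewrite pdiE mxE => /eqP.
  by rewrite mulf_eq0 (negPf Q0) => /eqP.
have gd'0 : graded_mx degr degr e d'0.
  move=> s t ne; apply: (frac_val_uniq (Vd' s t)); rewrite gd' //; exact: frac_val0.
have d'0d'0 : d'0 *m d'0 = 0.
  by apply: mx_val_uniq (mx_valM Vd' Vd') _; rewrite d'd'; apply: mx_val0.
have di0 := contraction_di (evdd q) dhd0 c0.
have pd0 := contraction_pd (evdd q) dhd0 c0.
have red := dirderiv_reduced xi Vi Vp Vd' pdiE pd0 di0 Qq.
have acyc := reduced_acyclic (evdd q) (dirderiv_anticommute q xi dd) dhd0 c0 ex Qxi red.
have [h'0 [c'0 gh'0]] := contraction_acyclic d'0d'0 gd'0 acyc.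
(* The contraction of [d'(q)] has empty inclusion and projection; lifting keeps them empty, so
   [i' p' = 0] reads [1 = d' h' + h' d']. *)
have [||h' [i' [p' [a' [c' [Vh' _ _] [gh' _ _] _ _]]]]] :=
  contraction_lift (degr := fun _ : 'I_0 => 0) Vd' d'd' c'0 gd' gh'0.
- exact: graded0.
- exact: graded0.
have [h'h' _ ip' _] := c'.
have hd' : h' *m d' + d' *m h' = 1%:M.
  move: ip'; rewrite (thinmx0 i') mul0mx => /esym/eqP.
  by rewrite -addrA -opprD subr_eq0 addrC => /eqP.
have [hh hdh ip pi] := c.
exists h, i, p, d', h'; split; [|split; [|split; [|split]]].
- by split=> //; [exists d'0 | exists h'0].
- by split.
- by split.
- exact: contraction_total Q0 dFdF c pdiE h'h' hd'.
- by split.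
Qed.

Theorem mainTheorem5 (R : realType) (m n : nat)
  (d : 'M[{mpoly R[i][m]}]_n) (Q : {mpoly R[i][m]}) (q : 'I_m -> R[i])
  (deg : 'I_n -> int) (e : int) :
  (* d is a differential *)
  d *m d = 0 ->
  (* grading: either ungraded (trivial grading, e = 0) or d of degree +1 or -1 *)
  ((e = 0 /\ forall a b, deg a = deg b) \/ e = 1 \/ e = -1) ->
  graded_mx deg deg e d ->
  mirreducible Q ->
  (forall k : 'I_m -> R[i], hdim (evalmx k d) != 0%N -> Q.@[k] = 0) ->
  regular_homology_point d Q q ->
  (exists (r : nat) (degr : 'I_r -> int) h i p d' h' h0 i0 p0,
      main_conclusion d Q q deg degr e h i p d' h' h0 i0 p0) /\
  (forall (r : nat) (degr : 'I_r -> int)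
          (h0 : 'M[R[i]]_n) (i0 : 'M[R[i]]_(n, r)) (p0 : 'M[R[i]]_(r, n)),
      cond_i_at_q (evalmx q d) h0 i0 p0 ->
      graded_mx deg deg (- e) h0 -> graded_mx deg degr 0 i0 ->
      graded_mx degr deg 0 p0 ->
      exists h i p d' h', main_conclusion d Q q deg degr e h i p d' h' h0 i0 p0).
Proof.
move=> dd _ gd irr _ reg.
have concl r (degr : 'I_r -> int) h0 i0 p0 := graded_contraction_conclusion
  (degr := degr) (h0 := h0) (i0 := i0) (p0 := p0) dd gd irr reg.
split; last by move=> r degr h0 i0 p0; apply: concl.
have d0d0 : evalmx q d *m evalmx q d = 0 by rewrite -evalmxM dd evalmx0.
have gd0 : graded_mx deg deg e (evalmx q d) by move=> s t ne; rewrite mxE gd // meval0.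
have [r [degr [h0 [i0 [p0 [cq gh gi gp]]]]]] := graded_contraction_exists d0d0 gd0.
have [h [i [p [d' [h' res]]]]] := concl r degr h0 i0 p0 cq gh gi gp.
by exists r, degr, h, i, p, d', h', h0, i0, p0.
Qed.
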